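(* Let $n\geqslant 0$ be a natural number and let $R$ be a ring such that $R$ contains $\frac{1}{2}$ and $R$ is weakly $5$-fold stable. Then the homomorphism $B\colon TK^M_{n+1}(R)\to\Omega_R^{n}$ is an isomorphism.
   Context: All rings are commutative, associative and unital. Milnor $K$-groups: for a ring $R$ and a natural number $n\geqslant 0$, $K_n^M(R)$ is the quotient of the group $(R^* )^{\otimes n}$ (tensor product over $\mathbb{Z}$, with $(R^* )^{\otimes 0}=\mathbb{Z}$) by the subgroup generated by all Steinberg relations $r_1\otimes\ldots\otimes r_i\otimes r\otimes(1-r)\otimes r_{i+3}\otimes\ldots\otimes r_n$ with $r_j\in R^*$ and $r,1-r\in R^*$ (the entries $r$ and $1-r$ are adjacent). Equivalently, it is the $n$-th homogeneous component of the quotient of $\bigoplus_{n\geqslant 0}(R^* )^{\otimes n}$ by the homogeneous ideal generated by the elements $r\otimes(1-r)\in R^*\otimes_{\mathbb{Z}}R^*$. No further relations are imposed. The group law is written additively, and the class of $r_1\otimes\ldots\otimes r_n$ is the symbol $\{r_1,\ldots,r_n\}$. $K^M_n$ is functorial in $R$. Weak stability: for a natural number $k\geqslant 2$, a ring $R$ is weakly $k$-fold stable if for any $r_1,\ldots,r_{k-1}\in R$ there is $r\in R^*$ such that $r_1+r,\ldots,r_{k-1}+r$ are all invertible in $R$. Tangent space: $\varepsilon$ denotes a formal variable with $\varepsilon^2=0$, so $R[\varepsilon]\simeq R[x]/(x^2)$. For a covariant functor $F$ from rings to abelian groups, $TF(R):=\mathrm{Ker}\big(F(R[\varepsilon])\to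 F(R)\big)$, where the map is induced by the ring homomorphism $R[\varepsilon]\to R$ that is the identity on $R$ and sends $\varepsilon$ to $0$. In particular, $TK^M_{n+1}(R)=\mathrm{Ker}\big(K^M_{n+1}(R[\varepsilon])\to K^M_{n+1}(R)\big)$. $\Omega^n_R$ denotes the group of $n$-th absolute Kähler differentials of $R$, that is, $\Omega^n_R=\bigwedge^n_R\Omega^1_{R/\mathbb{Z}}$ (so $\Omega^0_R=R$), and $\Omega^n$ is the corresponding functor $R\mapsto\Omega^n_R$. There is an isomorphism of $R$-modules $$T\Omega^{n+1}(R)\simeq \big(\varepsilon\,\Omega^{n+1}_R\big)\oplus \big(d\varepsilon\wedge\Omega^n_R\big)\oplus \left(\big(\varepsilon d\varepsilon\wedge\Omega^n_R\big)/2\big(\varepsilon d\varepsilon\wedge\Omega^n_R\big) \right),$$ where the last summand is zero if $\frac12\in R$. The homomorphism $B\colon TK^M_{n+1}(R)\to\Omega^n_R$ is the composition of the map $TK^M_{n+1}(R)\to T\Omega^{n+1}(R)$ induced by $d\log\colon K^M_{n+1}(R[\varepsilon])\to\Omega^{n+1}_{R[\varepsilon]}$, $\{u_1,\ldots,u_{n+1}\}\mapsto \frac{du_1}{u_1}\wedge\ldots\wedge\frac{du_{n+1}}{u_{n+1}}$, with the projection to the direct summand $d\varepsilon\wedge\Omega^n_R\simeq\Omega^n_R$ in the decomposition above. *)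

(* Defs.v *)
From HB Require Import structures.
From mathcomp Require Import all_boot all_algebra.
From mathcomp Require Import generic_quotient finmap boolp.

Set Implicit Arguments.
Unset Strict Implicit.
Unset Printing Implicit Defensive.

Import GRing.Theory.
Local Open Scope fset_scope.
Local Open Scope ring_scope.
Local Open Scope quotient_scope.

(* Rings are comPzRingType, so the zero ring is allowed; the free modules of the
   multinomials library require a nonzero ring. *)
Definition freemod (S : pzRingType) (T : choiceType) := {fsfun T -> S with 0}.

Section FreeModule.
Variables (S : pzRingType) (T : choiceType).
Implicit Types (x y z : freemod S T) (t : T) (a b : S).

HB.instance Definition _ := Choice.on (freemod S T).

Definition fm_coef (x : freemod S T) (t : T) : S :=
  (x : {fsfun T -> S with 0}) t.

Lemma fm_eqP x y : (forall t, fm_coef x t = fm_coef y t) -> x = y.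
Proof. by move=> H; apply/fsfunP. Qed.

Definition fm_zero : freemod S T := [fsfun].
Definition fm_opp x : freemod S T := [fsfun t in finsupp x => - fm_coef x t].
Definition fm_add x y : freemod S T :=
  [fsfun t in finsupp x `|` finsupp y => fm_coef x t + fm_coef y t].
Definition fm_scale a x : freemod S T := [fsfun t in finsupp x => a * fm_coef x t].
Definition fgen t : freemod S T := [fsfun u in [fset t] => 1].

Lemma fm_coef0E t : fm_coef fm_zero t = 0.
Proof. by rewrite /fm_coef fsfun0E. Qed.
Lemma fm_coefNE x t : fm_coef (fm_opp x) t = - fm_coef x t.
Proof. by rewrite /fm_coef fsfunE /fm_coef; case: finsuppP; rewrite ?oppr0. Qed.
Lemma fm_coefDE x y t : fm_coef (fm_add x y) t = fm_coef x t + fm_coef y t.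
Proof.
rewrite /fm_coef fsfunE /fm_coef in_fsetU.
by case: (finsuppP x); case: (finsuppP y) => //= *; rewrite ?addr0 ?add0r.
Qed.
Lemma fm_coefZE a x t : fm_coef (fm_scale a x) t = a * fm_coef x t.
Proof. by rewrite /fm_coef fsfunE /fm_coef; case: finsuppP; rewrite ?mulr0. Qed.
Let cE := (fm_coef0E, fm_coefNE, fm_coefDE, fm_coefZE).

Lemma fm_addA : associative fm_add.
Proof. by move=> x y z; apply: fm_eqP => t; rewrite !cE addrA. Qed.
Lemma fm_addC : commutative fm_add.
Proof. by move=> x y; apply: fm_eqP => t; rewrite !cE addrC. Qed.
Lemma fm_add0 : left_id fm_zero fm_add.
Proof. by move=> x; apply: fm_eqP => t; rewrite !cE add0r. Qed.
Lemma fm_addN : left_inverse fm_zero fm_opp fm_add.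
Proof. by move=> x; apply: fm_eqP => t; rewrite !cE addNr. Qed.
HB.instance Definition _ :=
  GRing.isZmodule.Build (freemod S T) fm_addA fm_addC fm_add0 fm_addN.

Lemma fm_scaleA a b x : fm_scale a (fm_scale b x) = fm_scale (a * b) x.
Proof. by apply: fm_eqP => t; rewrite !cE mulrA. Qed.
Lemma fm_scale1 : left_id 1 fm_scale.
Proof. by move=> x; apply: fm_eqP => t; rewrite !cE mul1r. Qed.
Lemma fm_scaleDr : right_distributive fm_scale +%R.
Proof. by move=> a x y; apply: fm_eqP => t; rewrite !cE mulrDr. Qed.
Lemma fm_scaleDl x : {morph fm_scale^~ x : a b / a + b}.
Proof. by move=> a b; apply: fm_eqP => t; rewrite !cE mulrDl. Qed.
HB.instance Definition _ := GRing.Zmodule_isLmodule.Build S (freemod S T)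
  fm_scaleA fm_scale1 fm_scaleDr fm_scaleDl.

Lemma fm_coef0 t : fm_coef 0 t = 0. Proof. exact: fm_coef0E. Qed.
Lemma fm_coefD x y t : fm_coef (x + y) t = fm_coef x t + fm_coef y t.
Proof. exact: fm_coefDE. Qed.
Lemma fm_coefZ a x t : fm_coef (a *: x) t = a * fm_coef x t.
Proof. exact: fm_coefZE. Qed.
Lemma fm_coef_gen t u : fm_coef (fgen t) u = (u == t)%:R.
Proof. by rewrite /fm_coef fsfunE /fm_coef inE; case: eqP. Qed.

Lemma fm_coef_sum I (r : seq I) (F : I -> freemod S T) t :
  fm_coef (\sum_(i <- r) F i) t = \sum_(i <- r) fm_coef (F i) t.
Proof.
elim: r => [|i r IH]; first by rewrite !big_nil fm_coef0.
by rewrite !big_cons fm_coefD IH.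
Qed.

Lemma fm_expand x : x = \sum_(t <- finsupp x) fm_coef x t *: fgen t.
Proof.
apply: fm_eqP => t; rewrite fm_coef_sum.
under eq_bigr do rewrite fm_coefZ fm_coef_gen.
case: (boolP (t \in finsupp x)) => tx.
  rewrite (big_fsetD1 t) //= eqxx mulr1 big1_fset ?addr0 // => u.
  by rewrite !inE eq_sym => /andP[/negbTE-> _]; rewrite mulr0.
rewrite big1_fset => [|u ux _]; first by rewrite /fm_coef fsfun_dflt.
by case: eqP ux tx => [->->//|]; rewrite mulr0.
Qed.

Lemma fm_ind (P : freemod S T -> Prop) :
  P 0 -> (forall a t x, P x -> P (a *: fgen t + x)) -> forall x, P x.
Proof.
move=> P0 PS x; rewrite (fm_expand x).
elim: (finsupp x : seq T) => [|t s IH]; first by rewrite big_nil.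
by rewrite big_cons; apply: PS.
Qed.
End FreeModule.
Arguments fgen {S T} t.

(* All maps out of a presented module are built semilinearly along a ring
   homomorphism phi, so that the same constructions give functoriality. *)
Section FreeModuleLift.
Variables (S S' : pzRingType) (phi : {rmorphism S -> S'}).
Variables (T : choiceType) (W : lmodType S') (g : T -> W).

Definition fm_lift (x : freemod S T) : W :=
  \sum_(t <- finsupp x) phi (fm_coef x t) *: g t.

Lemma fm_lift_widen (A : {fset T}) (x : freemod S T) : finsupp x `<=` A ->
  fm_lift x = \sum_(t <- A) phi (fm_coef x t) *: g t.
Proof.
move=> sxA; apply: big_fset_incl => // t _ tx.
by rewrite /fm_coef fsfun_dflt // rmorph0 scale0r.
Qed.

Lemma fm_lift_is_linear : linear_for (phi \; *:%R) fm_lift.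
Proof.
move=> a x y /=.
rewrite (@fm_lift_widen (finsupp (a *: x + y) `|` finsupp x `|` finsupp y)).
  2: by rewrite -fsetUA fsubsetUl.
rewrite (@fm_lift_widen (finsupp (a *: x + y) `|` finsupp x `|` finsupp y) x).
  2: by rewrite fsetUAC fsubsetUr.
rewrite (@fm_lift_widen (finsupp (a *: x + y) `|` finsupp x `|` finsupp y) y).
  2: by rewrite fsubsetUr.
rewrite scaler_sumr -big_split /=; apply: eq_bigr => t _.
by rewrite fm_coefD fm_coefZ rmorphD rmorphM scalerDl scalerA.
Qed.
HB.instance Definition _ := GRing.isLinear.Build S (freemod S T) W
  (phi \; *:%R) fm_lift fm_lift_is_linear.

Lemma fm_lift_gen t : fm_lift (fgen t) = g t.
Proof.
rewrite (@fm_lift_widen [fset t]); last first.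
  by apply/fsubsetP => u; rewrite mem_finsupp fsfunE; case: ifP => //; rewrite eqxx.
by rewrite big_seq_fset1 fm_coef_gen eqxx rmorph1 scale1r.
Qed.
End FreeModuleLift.

Section QuotientModule.
Variables (S : pzRingType) (V : lmodType S) (G : V -> Prop).

Inductive spanned : V -> Prop :=
| spanned0 : spanned 0
| spanned_gen g : G g -> spanned g
| spanned_comb a u v : spanned u -> spanned v -> spanned (a *: u + v).

Lemma spannedZ a u : spanned u -> spanned (a *: u).
Proof.
by move=> Hu; rewrite -[a *: u]addr0; apply: spanned_comb => //; apply: spanned0.
Qed.
Lemma spannedD u v : spanned u -> spanned v -> spanned (u + v).
Proof. by move=> Hu Hv; rewrite -[u]scale1r; apply: spanned_comb. Qed.
Lemma spannedN u : spanned u -> spanned (- u).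
Proof. by move=> Hu; rewrite -scaleN1r; apply: spannedZ. Qed.

Definition qm_rel : rel V := fun u v => `[< spanned (u - v) >].

Lemma qm_rel_refl : reflexive qm_rel.
Proof. by move=> u; apply/asboolP; rewrite subrr; apply: spanned0. Qed.
Lemma qm_rel_sym : symmetric qm_rel.
Proof.
by move=> u v; apply/asboolP/asboolP => /spannedN; rewrite opprB.
Qed.
Lemma qm_rel_trans : transitive qm_rel.
Proof.
move=> v u w /asboolP Huv /asboolP Hvw; apply/asboolP.
by have := spannedD Huv Hvw; rewrite addrA subrK.
Qed.
Canonical qm_equiv := EquivRel qm_rel qm_rel_refl qm_rel_sym qm_rel_trans.
Canonical qm_encModRel := defaultEncModRel qm_rel.

Definition quotmod := {eq_quot qm_rel}.
HB.instance Definition _ := Choice.on quotmod.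
HB.instance Definition _ := EqQuotient.on quotmod.

Definition qm_pi (v : V) : quotmod := \pi v.

Lemma qm_piP u v : qm_pi u = qm_pi v <-> spanned (u - v).
Proof. by split=> [/eqmodP/asboolP|H]; last by apply/eqmodP/asboolP. Qed.

Lemma qm_ind (P : quotmod -> Prop) :
  (forall v, P (qm_pi v)) -> forall q, P q.
Proof. by move=> H q; rewrite -[q]reprK; apply: H. Qed.

Lemma qm_repr v : spanned (repr (qm_pi v) - v).
Proof. by apply/qm_piP; rewrite /qm_pi reprK. Qed.
End QuotientModule.

(* The operations on quotients, and the maps out of them, are sealed only to
   keep unification from unfolding them. *)
HB.lock Definition qm_add (S : pzRingType) (V : lmodType S) (G : V -> Prop)
  (p q : quotmod G) : quotmod G := qm_pi G (repr p + repr q).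
HB.lock Definition qm_opp (S : pzRingType) (V : lmodType S) (G : V -> Prop)
  (p : quotmod G) : quotmod G := qm_pi G (- repr p).
HB.lock Definition qm_scale (S : pzRingType) (V : lmodType S) (G : V -> Prop)
  (a : S) (p : quotmod G) : quotmod G := qm_pi G (a *: repr p).
HB.lock Definition qm_lift (S : pzRingType) (V : lmodType S) (G : V -> Prop)
  (S' : pzRingType) (phi : {rmorphism S -> S'}) (W : lmodType S')
  (f : {linear V -> W | phi \; *:%R}) (fG : forall g, G g -> f g = 0)
  (q : quotmod G) : W := f (repr q).

Section QuotientModuleTheory.
Variables (S : pzRingType) (V : lmodType S) (G : V -> Prop).
Local Notation qm_pi := (qm_pi G).
Local Notation quotmod := (quotmod G).
Local Notation qm_add := (@qm_add S V G).
Local Notation qm_opp := (@qm_opp S V G).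
Local Notation qm_scale := (@qm_scale S V G).
Implicit Types (p q : quotmod) (u v : V).

Lemma qm_addE u v : qm_add (qm_pi u) (qm_pi v) = qm_pi (u + v).
Proof.
rewrite qm_add.unlock; apply/qm_piP.
by rewrite opprD addrACA; apply: spannedD; apply: qm_repr.
Qed.
Lemma qm_oppE u : qm_opp (qm_pi u) = qm_pi (- u).
Proof.
rewrite qm_opp.unlock; apply/qm_piP.
by rewrite -opprD; apply/spannedN/qm_repr.
Qed.
Lemma qm_scaleE a u : qm_scale a (qm_pi u) = qm_pi (a *: u).
Proof.
rewrite qm_scale.unlock; apply/qm_piP.
by rewrite -scalerBr; apply/spannedZ/qm_repr.
Qed.

Lemma qm_addA : associative qm_add.
Proof. by do 3![elim/qm_ind=> ?]; rewrite !qm_addE addrA. Qed.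
Lemma qm_addC : commutative qm_add.
Proof. by do 2![elim/qm_ind=> ?]; rewrite !qm_addE addrC. Qed.
Lemma qm_add0 : left_id (qm_pi 0) qm_add.
Proof. by elim/qm_ind=> ?; rewrite qm_addE add0r. Qed.
Lemma qm_addN : left_inverse (qm_pi 0) qm_opp qm_add.
Proof. by elim/qm_ind=> ?; rewrite qm_oppE qm_addE addNr. Qed.
HB.instance Definition _ :=
  GRing.isZmodule.Build quotmod qm_addA qm_addC qm_add0 qm_addN.

Lemma qm_piD u v : qm_pi (u + v) = qm_pi u + qm_pi v.
Proof. by rewrite -qm_addE. Qed.

Lemma qm_scaleA a b q : qm_scale a (qm_scale b q) = qm_scale (a * b) q.
Proof. by elim/qm_ind: q => ?; rewrite !qm_scaleE scalerA. Qed.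
Lemma qm_scale1 : left_id 1 qm_scale.
Proof. by elim/qm_ind=> ?; rewrite qm_scaleE scale1r. Qed.
Lemma qm_scaleDr : right_distributive qm_scale +%R.
Proof.
move=> a; do 2![elim/qm_ind=> ?].
by rewrite -qm_piD !qm_scaleE -qm_piD scalerDr.
Qed.
Lemma qm_scaleDl q : {morph qm_scale^~ q : a b / a + b}.
Proof.
by move=> a b; elim/qm_ind: q => ?; rewrite !qm_scaleE -qm_piD scalerDl.
Qed.
HB.instance Definition _ := GRing.Zmodule_isLmodule.Build S quotmod
  qm_scaleA qm_scale1 qm_scaleDr qm_scaleDl.

Lemma qm_piZ a u : qm_pi (a *: u) = a *: qm_pi u.
Proof. by rewrite -qm_scaleE. Qed.

Lemma qm_pi_is_linear : linear qm_pi.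
Proof. by move=> a u v; rewrite qm_piD -qm_scaleE. Qed.
HB.instance Definition _ := GRing.isLinear.Build S V quotmod *:%R qm_pi
  qm_pi_is_linear.

Lemma qm_pi_eq0 g : G g -> qm_pi g = 0.
Proof.
move=> Gg; rewrite -[0](linear0 qm_pi); apply/qm_piP.
by rewrite subr0; apply: spanned_gen.
Qed.

Section Lift.
Variables (S' : pzRingType) (phi : {rmorphism S -> S'}) (W : lmodType S').
Variable f : {linear V -> W | phi \; *:%R}.
Variable fG : forall g, G g -> f g = 0.

Lemma qm_lift_pi v : qm_lift fG (qm_pi v) = f v.
Proof.
apply/eqP; rewrite qm_lift.unlock -subr_eq0 -linearB; apply/eqP.
elim: (qm_repr G v) => [|g /fG //|a u w _ IHu _ IHw]; first exact: linear0.
by rewrite linearP /= IHu IHw scaler0 addr0.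
Qed.

Lemma qm_lift_is_linear : linear_for (phi \; *:%R) (qm_lift fG).
Proof.
move=> a; do 2![elim/qm_ind=> ?].
by rewrite -linearP !qm_lift_pi linearP.
Qed.
HB.instance Definition _ := GRing.isLinear.Build S quotmod W
  (phi \; *:%R) (qm_lift fG) qm_lift_is_linear.
End Lift.
End QuotientModuleTheory.

Section Families.
Variables (M : Type) (n : nat).
Implicit Types (w x : M).

Definition upd m (f : {ffun 'I_m -> M}) i x : {ffun 'I_m -> M} :=
  [ffun j => if j == i then x else f j].

Definition fcons w (f : {ffun 'I_n -> M}) : {ffun 'I_n.+1 -> M} :=
  [ffun i => if unlift ord0 i is Some j then f j else w].
Definition ftail (f : {ffun 'I_n.+1 -> M}) : {ffun 'I_n -> M} :=
  [ffun i => f (lift ord0 i)].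

Lemma fcons0 w f : fcons w f ord0 = w.
Proof. by rewrite ffunE unlift_none. Qed.
Lemma fconsS w f i : fcons w f (lift ord0 i) = f i.
Proof. by rewrite ffunE liftK. Qed.
Lemma ftail_fcons w f : ftail (fcons w f) = f.
Proof. by apply/ffunP => i; rewrite ffunE fconsS. Qed.
Lemma fconsE (f : {ffun 'I_n.+1 -> M}) : f = fcons (f ord0) (ftail f).
Proof.
apply/ffunP => i; case: (unliftP ord0 i) => [j|] ->; last by rewrite fcons0.
by rewrite fconsS ffunE.
Qed.
Lemma upd_fcons0 w f x : upd (fcons w f) ord0 x = fcons x f.
Proof.
apply/ffunP => i; rewrite ffunE; case: (unliftP ord0 i) => [j|] ->.
  by rewrite eq_sym (negbTE (neq_lift _ _)) !fconsS.
by rewrite eqxx fcons0.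
Qed.
Lemma upd_fconsS w f i x : upd (fcons w f) (lift ord0 i) x = fcons w (upd f i x).
Proof.
apply/ffunP => k; rewrite ffunE; case: (unliftP ord0 k) => [j|] ->.
  by rewrite (inj_eq lift_inj) !fconsS ffunE.
by rewrite (negbTE (neq_lift _ _)) !fcons0.
Qed.
End Families.

Section TensorPower.
Variables (S : comPzRingType) (M : lmodType S) (n : nat).

Inductive tens_rel : freemod S {ffun 'I_n -> M} -> Prop :=
| tens_relD f i x y :
    tens_rel (fgen (upd f i (x + y)) - (fgen (upd f i x) + fgen (upd f i y)))
| tens_relZ f i a x :
    tens_rel (fgen (upd f i (a *: x)) - a *: fgen (upd f i x)).

(* The n-fold tensor power of M over S; for n = 0 there are no relations, and
   tens is free of rank one on the empty tensor. *)
Definition tens := quotmod tens_rel.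
HB.instance Definition _ := GRing.Lmodule.on tens.

Definition tensor (f : {ffun 'I_n -> M}) : tens := qm_pi tens_rel (fgen f).

Lemma tens_ind (P : tens -> Prop) :
  P 0 -> (forall a f x, P x -> P (a *: tensor f + x)) -> forall x, P x.
Proof.
move=> P0 PS; elim/qm_ind => v; elim/fm_ind: v => [|a f x IH].
  by rewrite linear0.
by rewrite linearP; apply: PS.
Qed.

Definition alternating (W : zmodType) (g : {ffun 'I_n -> M} -> W) :=
  forall (f : {ffun 'I_n -> M}) i j, i != j -> f i = f j -> g f = 0.

Inductive ext_rel : tens -> Prop :=
| ext_rel_alt (f : {ffun 'I_n -> M}) (i j : 'I_n) :
    i != j -> f i = f j -> ext_rel (tensor f).

Definition ext := quotmod ext_rel.
HB.instance Definition _ := GRing.Lmodule.on ext.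

Definition wedge (f : {ffun 'I_n -> M}) : ext := qm_pi ext_rel (tensor f).

Lemma ext_ind (P : ext -> Prop) :
  P 0 -> (forall a f x, P x -> P (a *: wedge f + x)) -> forall x, P x.
Proof.
move=> P0 PS; elim/qm_ind => v; elim/tens_ind: v => [|a f x IH].
  by rewrite linear0.
by rewrite linearP; apply: PS.
Qed.

Section Lift.
Variables (S' : comPzRingType) (phi : {rmorphism S -> S'}) (W : lmodType S').
Variable g : {ffun 'I_n -> M} -> W.

Definition multilinear_for :=
  (forall f i x y, g (upd f i (x + y)) = g (upd f i x) + g (upd f i y)) /\
  (forall f i a x, g (upd f i (a *: x)) = phi a *: g (upd f i x)).

Lemma tens_lift_subproof (gM : multilinear_for) r :
  tens_rel r -> fm_lift phi g r = 0.
Proof.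
case: gM => gD gZ; case=> [f i x y|f i a x]; apply/eqP.
  by rewrite linearB linearD subr_eq0 /= !fm_lift_gen gD.
by rewrite linearB linearZ subr_eq0 /= !fm_lift_gen gZ.
Qed.

Definition tens_lift (gM : multilinear_for) : tens -> W :=
  qm_lift (tens_lift_subproof gM).
HB.instance Definition _ gM := GRing.Linear.on (tens_lift gM).

Lemma tens_lift_tensor gM f : tens_lift gM (tensor f) = g f.
Proof. by rewrite /tens_lift /tensor qm_lift_pi; apply: fm_lift_gen. Qed.

Variables (gM : multilinear_for) (gA : alternating g).

Lemma ext_lift_subproof r : ext_rel r -> tens_lift gM r = 0.
Proof. by case=> f i j ij fij; rewrite tens_lift_tensor; apply: gA ij fij. Qed.

Definition ext_lift : ext -> W := qm_lift ext_lift_subproof.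
HB.instance Definition _ := GRing.Linear.on ext_lift.

Lemma ext_lift_wedge f : ext_lift (wedge f) = g f.
Proof. by rewrite /ext_lift /wedge qm_lift_pi; apply: tens_lift_tensor. Qed.
End Lift.

Lemma tensorD f i x y :
  tensor (upd f i (x + y)) = tensor (upd f i x) + tensor (upd f i y).
Proof. by rewrite /tensor -qm_piD; apply/qm_piP/spanned_gen/tens_relD. Qed.
Lemma tensorZ f i a x : tensor (upd f i (a *: x)) = a *: tensor (upd f i x).
Proof. by rewrite /tensor -qm_piZ; apply/qm_piP/spanned_gen/tens_relZ. Qed.
Lemma wedge_multilinear : multilinear_for idfun wedge.
Proof.
split=> [f i x y|f i a x]; first by rewrite /wedge tensorD qm_piD.
by rewrite /wedge tensorZ qm_piZ.
Qed.
Lemma wedge_alternating : alternating wedge.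
Proof. by move=> f i j ij fij; apply/qm_pi_eq0/(ext_rel_alt ij fij). Qed.
End TensorPower.

Section ExteriorMaps.
Variables (S : comPzRingType) (M : lmodType S).
Implicit Types (w v : M) (n : nat).

Lemma updE n (f : {ffun 'I_n -> M}) i : upd f i (f i) = f.
Proof. by apply/ffunP => j; rewrite ffunE; case: eqP => [->|]. Qed.

Lemma wedge_colinear n (f : {ffun 'I_n -> M}) i j c :
  i != j -> f j = c *: f i -> wedge f = 0.
Proof.
move=> ij fij; rewrite -[f](updE _ j) fij.
case: (wedge_multilinear M n) => _ ->.
rewrite (wedge_alternating ij) ?scaler0 // !ffunE eqxx.
by rewrite (negbTE ij).
Qed.

Section Functoriality.
Variables (S' : comPzRingType) (phi : {rmorphism S -> S'}) (M' : lmodType S').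
Variables (p : {linear M -> M' | phi \; *:%R}) (n : nat).

Definition fmap_at m (f : {ffun 'I_m -> M}) : {ffun 'I_m -> M'} :=
  [ffun i => p (f i)].

Lemma fmap_upd m (f : {ffun 'I_m -> M}) i x :
  fmap_at (upd f i x) = upd (fmap_at f) i (p x).
Proof. by apply/ffunP => j; rewrite !ffunE; case: eqP. Qed.

Lemma wedge_fmap_multilinear :
  multilinear_for phi (fun f : {ffun 'I_n -> M} => wedge (fmap_at f)).
Proof.
case: (wedge_multilinear M' n) => wD wZ.
split=> [f i x y|f i a x]; rewrite !fmap_upd; first by rewrite linearD wD.
by rewrite linearZ wZ.
Qed.

Lemma wedge_fmap_alternating :
  alternating (fun f : {ffun 'I_n -> M} => wedge (fmap_at f)).
Proof.
move=> f i j ij fij; apply: (wedge_alternating ij).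
by rewrite !ffunE fij.
Qed.

Definition ext_map : ext M n -> ext M' n :=
  ext_lift wedge_fmap_multilinear wedge_fmap_alternating.
HB.instance Definition _ := GRing.Linear.on ext_map.

Lemma ext_map_wedge f : ext_map (wedge f) = wedge (fmap_at f).
Proof. exact: ext_lift_wedge. Qed.
End Functoriality.

Section LeftWedge.
Variables (n : nat) (w : M).

Lemma wedgel_multilinear :
  multilinear_for idfun (fun f : {ffun 'I_n -> M} => wedge (fcons w f)).
Proof.
case: (wedge_multilinear M n.+1) => wD wZ.
by split=> [f i x y|f i a x]; rewrite -!upd_fconsS ?wD ?wZ.
Qed.

Lemma wedgel_alternating :
  alternating (fun f : {ffun 'I_n -> M} => wedge (fcons w f)).
Proof.
move=> f i j ij fij; apply: (@wedge_alternating _ _ _ _ (lift ord0 i) (lift ord0 j)).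
  by rewrite (inj_eq lift_inj).
by rewrite !fconsS.
Qed.

Definition wedgel : ext M n -> ext M n.+1 :=
  ext_lift wedgel_multilinear wedgel_alternating.
HB.instance Definition _ := GRing.Linear.on wedgel.

Lemma wedgel_wedge f : wedgel (wedge f) = wedge (fcons w f).
Proof. exact: ext_lift_wedge. Qed.

Lemma wedgelD x y : wedgel (x + y) = wedgel x + wedgel y.
Proof. exact: linearD. Qed.
Lemma wedgelN x : wedgel (- x) = - wedgel x.
Proof. exact: linearN. Qed.
Lemma wedgel0 : wedgel 0 = 0.
Proof. exact: linear0. Qed.
Lemma wedgelZ a x : wedgel (a *: x) = a *: wedgel x.
Proof. exact: linearZ. Qed.
End LeftWedge.

Lemma wedgelwD n w v (x : ext M n) : wedgel (w + v) x = wedgel w x + wedgel v x.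
Proof.
elim/ext_ind: x => [|a f x IH]; first by rewrite !wedgel0 addr0.
rewrite !(wedgelD, wedgelZ, wedgel_wedge) IH addrACA -scalerDr.
congr (_ *: _ + _); case: (wedge_multilinear M n.+1) => wD _.
by rewrite -(upd_fcons0 0 f (w + v)) wD !upd_fcons0.
Qed.

Lemma wedgelwZ n a w (x : ext M n) : wedgel (a *: w) x = a *: wedgel w x.
Proof.
elim/ext_ind: x => [|b f x IH]; first by rewrite !wedgel0 scaler0.
rewrite !(wedgelD, wedgelZ, wedgel_wedge) IH scalerDr !scalerA [a * b]mulrC.
rewrite -scalerA; congr (_ *: _ + _).
case: (wedge_multilinear M n.+1) => _ wZ.
by rewrite -(upd_fcons0 0 f (a *: w)) wZ !upd_fcons0.
Qed.

Lemma wedgelw0 n (x : ext M n) : wedgel 0 x = 0.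
Proof. by rewrite -(scale0r 0) wedgelwZ scale0r. Qed.

Lemma wedgelw_mem n w (f : {ffun 'I_n -> M}) i : f i = w -> wedgel w (wedge f) = 0.
Proof.
move=> fi; rewrite wedgel_wedge.
apply: (@wedge_alternating _ _ _ _ ord0 (lift ord0 i)); first exact: neq_lift.
by rewrite fcons0 fconsS.
Qed.

Lemma wedgelww n w (x : ext M n) : wedgel w (wedgel w x) = 0.
Proof.
elim/ext_ind: x => [|a f x IH]; first by rewrite !wedgel0.
have -> : wedgel w (a *: wedge f + x) = a *: wedge (fcons w f) + wedgel w x.
  by rewrite wedgelD wedgelZ wedgel_wedge.
rewrite wedgelD wedgelZ IH addr0.
by rewrite (@wedgelw_mem _ _ _ ord0) ?scaler0 ?fcons0.
Qed.

Lemma wedgelC n w v (x : ext M n) : wedgel w (wedgel v x) = - wedgel v (wedgel w x).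
Proof.
apply/eqP; rewrite -addr_eq0; apply/eqP.
have := wedgelww (w + v) x.
by rewrite !(wedgelwD, wedgelD) !wedgelww add0r addr0.
Qed.
End ExteriorMaps.

Section Contraction.
Variables (S S' : comPzRingType) (phi : {rmorphism S -> S'}).
Variables (M : lmodType S) (M' : lmodType S').
Variable p : {linear M -> M' | phi \; *:%R}.
Variable l : {linear M -> S'^o | phi \; *:%R}.

(* The map x_0 /\ ... /\ x_n |->
   \sum_i (-1)^i l(x_i) p(x_0) /\ .. ^i .. /\ p(x_n), by recursion. *)
Fixpoint contr_fun n : {ffun 'I_n.+1 -> M} -> ext M' n :=
  if n is n'.+1 then fun f =>
    (l (f ord0) : S') *: wedge (fmap_at p (ftail f))
      - wedgel (p (f ord0)) (contr_fun (ftail f))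
  else fun f => (l (f ord0) : S') *: wedge (fmap_at p (ftail f)).

Lemma fmap_fcons n w (f : {ffun 'I_n -> M}) :
  fmap_at p (fcons w f) = fcons (p w) (fmap_at p f).
Proof.
apply/ffunP => i; rewrite ffunE; case: (unliftP ord0 i) => [j|] ->.
  by rewrite !fconsS ffunE.
by rewrite !fcons0.
Qed.

Lemma contr_fun_fconsS n w (f : {ffun 'I_n.+1 -> M}) :
  contr_fun (fcons w f) =
  (l w : S') *: wedge (fmap_at p f) - wedgel (p w) (contr_fun f).
Proof. by rewrite /= fcons0 ftail_fcons. Qed.

Lemma contr_fun_fcons n w (f : {ffun 'I_n -> M}) : p w = 0 ->
  contr_fun (fcons w f) = (l w : S') *: wedge (fmap_at p f).
Proof.
by case: n f => [|n] f pw; rewrite /= fcons0 ftail_fcons // pw wedgelw0 subr0.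
Qed.

Lemma contr_multilinear n : multilinear_for phi (@contr_fun n).
Proof.
elim: n => [|n [IHD IHZ]].
  split=> [f i x y|f i a x]; rewrite [f]fconsE (ord1 i) !upd_fcons0 /=;
    rewrite !fcons0 !ftail_fcons.
    by rewrite linearD scalerDl.
  by rewrite linearZ /= scalerA.
case: (wedge_fmap_multilinear p n.+1) => wD wZ.
split=> [f i x y|f i a x]; rewrite [f]fconsE;
  case: (unliftP ord0 i) => [j|] ->;
  rewrite ?upd_fcons0 ?upd_fconsS !contr_fun_fconsS.
- by rewrite wD IHD wedgelD scalerDr opprD addrACA.
- by rewrite !linearD wedgelwD scalerDl opprD addrACA.
- by rewrite wZ IHZ wedgelZ scalerA mulrC -scalerA -scalerBr.
- by rewrite !linearZ /= wedgelwZ -scalerA -scalerBr.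
Qed.

Lemma contr_fun_mem n (f : {ffun 'I_n.+1 -> M}) i x : f i = x ->
  wedgel (p x) (contr_fun f) = (l x : S') *: wedge (fmap_at p f).
Proof.
elim: n f i => [|n IH] f i; rewrite [f]fconsE.
  rewrite (ord1 i) fcons0 => ->.
  by rewrite /= fcons0 ftail_fcons wedgelZ wedgel_wedge fmap_fcons.
rewrite contr_fun_fconsS fmap_fcons -wedgel_wedge wedgelD wedgelN wedgelZ.
case: (unliftP ord0 i) => [j|] ->; last first.
  by rewrite fcons0 => ->; rewrite wedgelww subr0.
rewrite fconsS => fj.
rewrite (@wedgelw_mem _ _ _ _ _ j); last by rewrite ffunE fj.
by rewrite scaler0 sub0r wedgelC opprK (IH _ j) // wedgelZ.
Qed.

Lemma contr_alternating n : alternating (@contr_fun n).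
Proof.
elim: n => [|n IH] f i j ij; first by rewrite (ord1 i) (ord1 j) in ij.
wlog: i j ij / (i <= j)%N => [H|].
  case/orP: (leq_total i j) => ij' fij; first exact: H ij ij' fij.
  by apply: H ij' _ => //; rewrite eq_sym.
rewrite [f]fconsE contr_fun_fconsS.
case: (unliftP ord0 j) ij => [j'|] ->; last first.
  by rewrite -val_eqE /= leqn0 => /negbTE->.
case: (unliftP ord0 i) => [i'|] ->; last first.
  rewrite fcons0 fconsS => _ _ H.
  by rewrite (@contr_fun_mem _ _ j') ?subrr.
rewrite (inj_eq lift_inj) !fconsS => ij _ fij.
rewrite (IH _ i' j') // wedgel0 subr0.
rewrite (@wedge_alternating _ _ _ _ i' j') ?scaler0 //.
by rewrite [LHS]ffunE [RHS]ffunE fij.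
Qed.

Definition contr n : ext M n.+1 -> ext M' n :=
  ext_lift (contr_multilinear n) (@contr_alternating n).
HB.instance Definition _ n := GRing.Linear.on (@contr n).

Lemma contr_wedgel n w (x : ext M n) : p w = 0 ->
  contr (wedgel w x) = (l w : S') *: ext_map p x.
Proof.
move=> pw; elim/ext_ind: x => [|a f x IH].
  by rewrite wedgel0 !linear0.
rewrite wedgelD wedgelZ wedgel_wedge [LHS]linearP [ext_map p _]linearP /= IH.
rewrite scalerDr; congr (_ + _).
rewrite ext_map_wedge scalerA mulrC -scalerA; congr (_ *: _).
by rewrite [LHS]ext_lift_wedge contr_fun_fcons.
Qed.
End Contraction.

Section Kahler.
Variable R : comPzRingType.

Inductive kahler_rel : freemod R R -> Prop :=
| kahler_relD a b : kahler_rel (fgen (a + b) - (fgen a + fgen b))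
| kahler_relM a b : kahler_rel (fgen (a * b) - (a *: fgen b + b *: fgen a)).

(* Omega^1_{R/Z}: the differential of an integer vanishes by kahler_relD. *)
Definition Omega1 := quotmod kahler_rel.
HB.instance Definition _ := GRing.Lmodule.on Omega1.

Definition kd (a : R) : Omega1 := qm_pi kahler_rel (fgen a).

Lemma kdD a b : kd (a + b) = kd a + kd b.
Proof. by rewrite /kd -qm_piD; apply/qm_piP/spanned_gen/kahler_relD. Qed.
Lemma kdM a b : kd (a * b) = a *: kd b + b *: kd a.
Proof. by rewrite /kd -!qm_piZ -qm_piD; apply/qm_piP/spanned_gen/kahler_relM. Qed.
Lemma kd0 : kd 0 = 0.
Proof. by apply: (addrI (kd 0)); rewrite -kdD !addr0. Qed.
Lemma kdN a : kd (- a) = - kd a.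
Proof. by apply/eqP; rewrite -addr_eq0 -kdD addNr kd0. Qed.
Lemma kd1 : kd 1 = 0.
Proof. by apply: (addrI (kd 1)); rewrite addr0 -[in RHS](mulr1 1) kdM !scale1r. Qed.

Lemma Omega1_ind (P : Omega1 -> Prop) :
  P 0 -> (forall a b x, P x -> P (a *: kd b + x)) -> forall x, P x.
Proof.
move=> P0 PS; elim/qm_ind => v; elim/fm_ind: v => [|a b x IH].
  by rewrite linear0.
by rewrite linearP; apply: PS.
Qed.

Section Lift.
Variables (R' : comPzRingType) (phi : {rmorphism R -> R'}) (W : lmodType R').
Variable D : R -> W.

Definition derivation_for :=
  (forall a b, D (a + b) = D a + D b) /\
  (forall a b, D (a * b) = phi a *: D b + phi b *: D a).

Lemma kahler_lift_subproof (HD : derivation_for) r :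
  kahler_rel r -> fm_lift phi D r = 0.
Proof.
case: HD => DD DM; case=> a b; apply/eqP.
  by rewrite linearB linearD subr_eq0 /= !fm_lift_gen DD.
by rewrite linearB linearD !linearZ subr_eq0 /= !fm_lift_gen DM.
Qed.

Definition kahler_lift (HD : derivation_for) : Omega1 -> W :=
  qm_lift (kahler_lift_subproof HD).
HB.instance Definition _ HD := GRing.Linear.on (kahler_lift HD).

Lemma kahler_lift_kd HD a : kahler_lift HD (kd a) = D a.
Proof. by rewrite /kahler_lift /kd qm_lift_pi; apply: fm_lift_gen. Qed.
End Lift.
End Kahler.

Definition Omega (n : nat) (R : comPzRingType) := ext (Omega1 R) n.
HB.instance Definition _ n R := GRing.Lmodule.on (Omega n R).

Section OmegaFunctor.
Variables (R R' : comPzRingType) (phi : {rmorphism R -> R'}).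

Lemma kd_map_derivation : derivation_for phi (fun a => kd (phi a)).
Proof. by split=> a b; rewrite ?rmorphD ?rmorphM ?kdD ?kdM. Qed.

Definition Omega1_map : Omega1 R -> Omega1 R' := kahler_lift kd_map_derivation.
HB.instance Definition _ := GRing.Linear.on Omega1_map.

Lemma Omega1_map_kd a : Omega1_map (kd a) = kd (phi a).
Proof. exact: kahler_lift_kd. Qed.

Definition Omega_map n : Omega n R -> Omega n R' := @ext_map _ _ _ _ _ Omega1_map n.
HB.instance Definition _ n := GRing.Linear.on (@Omega_map n).
End OmegaFunctor.

Section Units.
Variable R : comPzRingType.

(* The unit group R^*, with its group law written additively: a unit is stored
   together with its inverse. *)
Record units := Units { units_val : R * R; _ : units_val.1 * units_val.2 == 1 }.
HB.instance Definition _ := [isSub for units_val].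
HB.instance Definition _ := [Choice of units by <:].

Definition uval (u : units) : R := (units_val u).1.
Definition uinv (u : units) : R := (units_val u).2.

Lemma uvalK u : uval u * uinv u = 1.
Proof. by case: u => x ux; apply/eqP. Qed.
Lemma uval_inj : injective uval.
Proof.
move=> u v uv; apply: val_inj; apply: injective_projections; first exact: uv.
change (uinv u = uinv v).
by rewrite -[LHS]mul1r -(uvalK v) -uv mulrAC uvalK mul1r.
Qed.

Definition mk_units (a b : R) (ab : a * b = 1) : units :=
  @Units (a, b) (introT eqP ab).

Definition units_one : units := mk_units (mulr1 1).
Lemma units_mul_subproof u v : (uval u * uval v) * (uinv u * uinv v) = 1.
Proof. by rewrite mulrACA !uvalK mulr1. Qed.
Definition units_mul u v : units := mk_units (units_mul_subproof u v).
Lemma units_inv_subproof u : uinv u * uval u = 1.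
Proof. by rewrite mulrC uvalK. Qed.
Definition units_inv u : units := mk_units (units_inv_subproof u).

Lemma units_mulA : associative units_mul.
Proof. by move=> u v w; apply: uval_inj; apply: mulrA. Qed.
Lemma units_mulC : commutative units_mul.
Proof. by move=> u v; apply: uval_inj; apply: mulrC. Qed.
Lemma units_mul1 : left_id units_one units_mul.
Proof. by move=> u; apply: uval_inj; apply: mul1r. Qed.
Lemma units_mulV : left_inverse units_one units_inv units_mul.
Proof. by move=> u; apply: uval_inj; apply: units_inv_subproof. Qed.
HB.instance Definition _ :=
  GRing.isZmodule.Build units units_mulA units_mulC units_mul1 units_mulV.

Lemma uvalD (u v : units) : uval (u + v) = uval u * uval v.
Proof. by []. Qed.
Lemma uinvD (u v : units) : uinv (u + v) = uinv u * uinv v.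
Proof. by []. Qed.

Definition is_unit (a : R) := exists b, a * b = 1.
End Units.

Definition units_map_subproof (R R' : comPzRingType) (phi : {rmorphism R -> R'})
  (u : units R) : phi (uval u) * phi (uinv u) = 1.
Proof. by rewrite -rmorphM uvalK rmorph1. Qed.
Definition units_map (R R' : comPzRingType) (phi : {rmorphism R -> R'})
  (u : zmodule (units R)) : zmodule (units R') :=
  mk_units (units_map_subproof phi u).

(* A homomorphism of abelian groups is semilinear over any phi : int -> S. *)
Section IntLinear.
Variables (U : zmodType) (S : pzRingType) (W : lmodType S).
Variables (phi : {rmorphism int -> S}) (h : zmodule U -> W).
Hypothesis hD : forall x y : U, h (x + y) = h x + h y.

Lemma int_semilinear : linear_for (phi \; *:%R) h.
Proof.
have h0 : h 0 = 0 by apply: (addrI (h 0)); rewrite -hD !addr0.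
have hN x : h (- x) = - h x.
  by apply/eqP; rewrite -addr_eq0 -hD addNr h0.
have hMn x k : h (x *+ k) = h x *+ k.
  by elim: k => [|k IH]; rewrite ?mulr0n // !mulrS hD IH.
move=> a x y /=; rewrite hD; congr (_ + _).
have phiE k : phi k%:Z = k%:R by rewrite -(rmorph_nat phi k) natz.
case: a => k; first by rewrite phiE scaler_nat -hMn.
by rewrite NegzE rmorphN phiE !scaleNr scaler_nat hN -hMn.
Qed.
End IntLinear.

Section Milnor.
Variables (n : nat) (R : comPzRingType).

Inductive steinberg_rel : tens (zmodule (units R)) n -> Prop :=
| steinberg_rel_intro (u : {ffun 'I_n -> zmodule (units R)}) (i j : 'I_n) :
    j = i.+1 :> nat -> uval (u j) = 1 - uval (u i) -> steinberg_rel (tensor u).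

(* Subgroups of the tensor power over Z are its submodules over int. *)
Definition milnorK := quotmod steinberg_rel.
HB.instance Definition _ := GRing.Lmodule.on milnorK.

Definition symbol (u : {ffun 'I_n -> zmodule (units R)}) : milnorK :=
  qm_pi steinberg_rel (tensor u).

Lemma milnorK_ind (P : milnorK -> Prop) :
  P 0 -> (forall a u x, P x -> P (a *: symbol u + x)) -> forall x, P x.
Proof.
move=> P0 PS; elim/qm_ind => v; elim/tens_ind: v => [|a f x IH].
  by rewrite linear0.
by rewrite linearP; apply: PS.
Qed.

Section Lift.
Variables (S : comPzRingType) (phi : {rmorphism int -> S}) (W : lmodType S).
Variable g : {ffun 'I_n -> zmodule (units R)} -> W.
Hypothesis gM : multilinear_for phi g.
Hypothesis gS : forall (u : {ffun 'I_n -> zmodule (units R)})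
  (i j : 'I_n), j = i.+1 :> nat -> uval (u j) = 1 - uval (u i) -> g u = 0.

Lemma milnorK_lift_subproof r : steinberg_rel r -> tens_lift gM r = 0.
Proof. by case=> u i j ij uij; rewrite tens_lift_tensor; apply: gS ij uij. Qed.

Definition milnorK_lift : milnorK -> W := qm_lift milnorK_lift_subproof.
HB.instance Definition _ := GRing.Linear.on milnorK_lift.

Lemma milnorK_lift_symbol u : milnorK_lift (symbol u) = g u.
Proof. by rewrite /milnorK_lift /symbol qm_lift_pi; apply: tens_lift_tensor. Qed.
End Lift.

Lemma symbol_multilinear : multilinear_for idfun symbol.
Proof.
split=> [f i x y|f i a x]; first by rewrite /symbol tensorD qm_piD.
by rewrite /symbol tensorZ qm_piZ.
Qed.
Lemma symbol_steinberg (u : {ffun 'I_n -> zmodule (units R)}) (i j : 'I_n) :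
  j = i.+1 :> nat -> uval (u j) = 1 - uval (u i) -> symbol u = 0.
Proof. by move=> ij uij; apply/qm_pi_eq0/(steinberg_rel_intro ij uij). Qed.
End Milnor.

Section MilnorFunctor.
Variables (R R' : comPzRingType) (phi : {rmorphism R -> R'}).

Lemma units_map_semilinear : linear_for (idfun \; *:%R) (units_map phi).
Proof. by apply: int_semilinear => u v; apply: uval_inj; apply: rmorphM. Qed.
HB.instance Definition _ := GRing.isLinear.Build int (zmodule (units R))
  (zmodule (units R')) (idfun \; *:%R) (units_map phi) units_map_semilinear.

Variable n : nat.
Let g (u : {ffun 'I_n -> zmodule (units R)}) : milnorK n R' :=
  symbol (fmap_at (units_map phi) u).

Lemma milnorK_map_multilinear : multilinear_for idfun g.
Proof.
case: (symbol_multilinear n R') => sD sZ.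
split=> [f i x y|f i a x]; rewrite /g !fmap_upd; first by rewrite linearD sD.
by rewrite linearZ sZ.
Qed.

Lemma milnorK_map_steinberg (u : {ffun 'I_n -> zmodule (units R)}) (i j : 'I_n) :
  j = i.+1 :> nat -> uval (u j) = 1 - uval (u i) -> g u = 0.
Proof.
move=> ij uij; apply: (symbol_steinberg ij); rewrite !ffunE.
by rewrite [LHS](congr1 phi uij) rmorphB rmorph1.
Qed.

Definition milnorK_map : milnorK n R -> milnorK n R' :=
  milnorK_lift milnorK_map_multilinear milnorK_map_steinberg.
HB.instance Definition _ := GRing.Linear.on milnorK_map.

Lemma milnorK_map_symbol u : milnorK_map (symbol u) = g u.
Proof. exact: milnorK_lift_symbol. Qed.
End MilnorFunctor.

Section Dlog.
Variable R : comPzRingType.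

Definition dlog1 (u : zmodule (units R)) : Omega1 R := uinv u *: kd (uval u).

Lemma dlog1_is_linear : linear_for (intr \; *:%R) dlog1.
Proof.
apply: int_semilinear => u v; rewrite /dlog1 uvalD uinvD.
rewrite kdM scalerDr scalerA [X in _ + X]scalerA addrC.
rewrite -[in X in X + _]mulrA [uinv v * uval v]mulrC uvalK mulr1.
by rewrite mulrAC [uinv u * uval u]mulrC uvalK mul1r.
Qed.
HB.instance Definition _ := GRing.isLinear.Build int (zmodule (units R))
  (Omega1 R) (intr \; *:%R) dlog1 dlog1_is_linear.

Variable n : nat.

Lemma dlog_steinberg (u : {ffun 'I_n -> zmodule (units R)}) (i j : 'I_n) :
  j = i.+1 :> nat -> uval (u j) = 1 - uval (u i) -> wedge (fmap_at dlog1 u) = 0.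
Proof.
move=> ij uij.
apply: (@wedge_colinear _ _ _ _ i j (- (uinv (u j) * uval (u i)))).
  by apply/eqP => eij; move: ij; rewrite eij => /eqP; rewrite ltn_eqF.
rewrite !ffunE /= /dlog1 uij kdD kd1 add0r kdN scalerN scaleNr scalerA.
by rewrite -mulrA uvalK mulr1.
Qed.

(* {u_1, .., u_n} |-> du_1/u_1 /\ .. /\ du_n/u_n *)
Definition dlog : milnorK n R -> Omega n R :=
  milnorK_lift (wedge_fmap_multilinear dlog1 n) dlog_steinberg.
HB.instance Definition _ := GRing.Linear.on dlog.

Lemma dlog_symbol u : dlog (symbol u) = wedge (fmap_at dlog1 u).
Proof. exact: milnorK_lift_symbol. Qed.
End Dlog.

Lemma dlog_natural (R R' : comPzRingType) (phi : {rmorphism R -> R'}) n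
    (x : milnorK n R) :
  Omega_map phi (dlog x) = dlog (milnorK_map phi x).
Proof.
elim/milnorK_ind: x => [|a u x IH]; first by rewrite !linear0.
have dP (S : comPzRingType) (y z : milnorK n S) :
  dlog (a *: y + z) = a%:~R *: dlog y + dlog z by rewrite linearP.
have -> : milnorK_map phi (a *: symbol u + x)
    = a *: milnorK_map phi (symbol u) + milnorK_map phi x by rewrite linearP.
rewrite !dP -IH [LHS]linearP /= rmorph_int; congr (_ *: _ + _).
rewrite milnorK_map_symbol !dlog_symbol [LHS]ext_map_wedge.
congr wedge; apply/ffunP => i; rewrite !ffunE /= /dlog1 linearZ /= Omega1_map_kd.
by [].
Qed.

Section DualNumbers.
Variable R : comPzRingType.

(* Dual x y stands for x + y eps, with eps^2 = 0. *)
Record dual := Dual { dual_re : R; dual_im : R }.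

Definition dual_pair (x : dual) := (dual_re x, dual_im x).
Definition pair_dual (p : R * R) := Dual p.1 p.2.
Lemma dual_pairK : cancel dual_pair pair_dual. Proof. by case. Qed.
HB.instance Definition _ := Choice.copy dual (can_type dual_pairK).

Lemma dual_eq x y : dual_re x = dual_re y -> dual_im x = dual_im y -> x = y.
Proof. by case: x y => x1 x2 [y1 y2] /= -> ->. Qed.

Definition dual_zero := Dual 0 0.
Definition dual_opp x := Dual (- dual_re x) (- dual_im x).
Definition dual_add x y := Dual (dual_re x + dual_re y) (dual_im x + dual_im y).
Definition dual_one := Dual 1 0.
Definition dual_mul x y :=
  Dual (dual_re x * dual_re y) (dual_re x * dual_im y + dual_re y * dual_im x).

Lemma dual_addA : associative dual_add.
Proof. by move=> x y z; apply: dual_eq; apply: addrA. Qed.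
Lemma dual_addC : commutative dual_add.
Proof. by move=> x y; apply: dual_eq; apply: addrC. Qed.
Lemma dual_add0 : left_id dual_zero dual_add.
Proof. by move=> x; apply: dual_eq; apply: add0r. Qed.
Lemma dual_addN : left_inverse dual_zero dual_opp dual_add.
Proof. by move=> x; apply: dual_eq; apply: addNr. Qed.
HB.instance Definition _ :=
  GRing.isZmodule.Build dual dual_addA dual_addC dual_add0 dual_addN.

Lemma dual_mulA : associative dual_mul.
Proof.
move=> x y z; apply: dual_eq; rewrite /= ?mulrA // !mulrDr !mulrA -addrA.
by rewrite [dual_re z * dual_re x]mulrC [dual_re z * dual_re y]mulrC addrA.
Qed.
Lemma dual_mulC : commutative dual_mul.
Proof. by move=> x y; apply: dual_eq; rewrite /= 1?mulrC // addrC. Qed.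
Lemma dual_mul1 : left_id dual_one dual_mul.
Proof. by move=> x; apply: dual_eq; rewrite /= mul1r // mulr0 addr0. Qed.
Lemma dual_mulDl : left_distributive dual_mul dual_add.
Proof.
move=> x y z; apply: dual_eq; rewrite /= mulrDl // mulrDr addrACA.
by [].
Qed.
HB.instance Definition _ := GRing.Zmodule_isComPzRing.Build dual
  dual_mulA dual_mulC dual_mul1 dual_mulDl.

Definition eps : dual := Dual 0 1.

Definition dual_inj (x : R) : dual := Dual x 0.
Lemma dual_inj_zmod : zmod_morphism dual_inj.
Proof. by move=> x y; apply: dual_eq => //=; rewrite subr0. Qed.
Lemma dual_inj_monoid : monoid_morphism dual_inj.
Proof.
by split=> // x y; apply: dual_eq => //=; rewrite !mulr0 addr0.
Qed.
HB.instance Definition _ := GRing.isZmodMorphism.Build R dual dual_inj dual_inj_zmod.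
HB.instance Definition _ :=
  GRing.isMonoidMorphism.Build R dual dual_inj dual_inj_monoid.

(* R[eps] -> R, the identity on R and eps |-> 0. *)
Definition dual_aug (x : dual) : R := dual_re x.
Lemma dual_aug_zmod : zmod_morphism dual_aug.
Proof. by []. Qed.
Lemma dual_aug_monoid : monoid_morphism dual_aug.
Proof. by []. Qed.
HB.instance Definition _ := GRing.isZmodMorphism.Build dual R dual_aug dual_aug_zmod.
HB.instance Definition _ :=
  GRing.isMonoidMorphism.Build dual R dual_aug dual_aug_monoid.

Lemma eps_sqr : eps * eps = 0.
Proof. by apply: dual_eq; rewrite /= ?mulr0 ?mul0r ?addr0. Qed.

Lemma dualE x : x = dual_inj (dual_re x) + eps * dual_inj (dual_im x).
Proof.
by apply: dual_eq; rewrite /= ?mul0r ?mulr0 ?mulr1 ?addr0 ?add0r.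
Qed.
End DualNumbers.

Section Kernel.
Variables (U V : zmodType) (f : {additive U -> V}).

Definition ker_pred : {pred U} := fun x => f x == 0.
Lemma ker_pred_zmod_closed : zmod_closed ker_pred.
Proof.
split=> [|x y]; rewrite /ker_pred !unfold_in ?raddf0 // => /eqP fx /eqP fy.
by rewrite raddfB fx fy subrr.
Qed.

Record kernel := Kernel { kernel_val : U; _ : ker_pred kernel_val }.
HB.instance Definition _ := [isSub for kernel_val].
HB.instance Definition _ := [Choice of kernel by <:].
HB.instance Definition _ :=
  GRing.SubChoice_isSubZmodule.Build U ker_pred kernel ker_pred_zmod_closed.

Lemma kernelP (x : kernel) : f (val x) = 0.
Proof. exact/eqP/(valP x). Qed.
Definition mk_kernel x (fx : f x = 0) : kernel := Kernel (introT eqP fx).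
End Kernel.

Section Tangent.
Variable (n : nat) (R : comPzRingType).

Definition TmilnorK := kernel (@milnorK_map _ _ (@dual_aug R) n).
HB.instance Definition _ := GRing.Zmodule.on TmilnorK.

Definition TOmega := kernel (@Omega_map _ _ (@dual_aug R) n).
HB.instance Definition _ := GRing.Zmodule.on TOmega.

Lemma Tdlog_subproof (x : TmilnorK) :
  Omega_map (@dual_aug R) (dlog (val x)) = 0.
Proof. by rewrite dlog_natural kernelP linear0. Qed.

Definition Tdlog (x : TmilnorK) : TOmega := mk_kernel (Tdlog_subproof x).

Lemma Tdlog_is_zmod_morphism : zmod_morphism Tdlog.
Proof. by move=> x y; apply: val_inj; apply: (linearB (@dlog (dual R) n)). Qed.
HB.instance Definition _ := GRing.isZmodMorphism.Build TmilnorK TOmega Tdlog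
  Tdlog_is_zmod_morphism.
End Tangent.

Section Decomposition.
Variable R : comPzRingType.
Local Notation inj := (@Omega_map R (dual R) (@dual_inj R) _).
Local Notation deps := (@wedgel (dual R) (Omega1 (dual R)) _ (kd (eps R))).

(* eps a + deps /\ b + eps deps /\ c; since 2 eps deps = d(eps^2) = 0, c only
   matters modulo 2. *)
Definition tangent_form n (a : Omega n.+1 R) (b c : Omega n R) :
    Omega n.+1 (dual R) :=
  eps R *: inj a + deps (inj b) + eps R *: deps (inj c).

Lemma kd_dual x :
  kd x = kd (dual_inj (dual_re x)) + dual_inj (dual_im x) *: kd (eps R)
         + eps R *: kd (dual_inj (dual_im x)).
Proof. by rewrite [in LHS](dualE x) kdD kdM addrA addrAC. Qed.

Lemma Omega_map_wedgel (R1 R2 : comPzRingType) (phi : {rmorphism R1 -> R2}) n w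
    (x : Omega n R1) :
  Omega_map phi (wedgel w x) = wedgel (Omega1_map phi w) (Omega_map phi x).
Proof.
elim/ext_ind: x => [|a f x IH]; first by rewrite wedgel0 !linear0.
have mP m b (y z : Omega m R1) :
  Omega_map phi (b *: y + z) = phi b *: Omega_map phi y + Omega_map phi z.
  by rewrite linearP.
rewrite wedgelD wedgelZ !mP wedgelD wedgelZ IH wedgel_wedge.
by rewrite [Omega_map phi (wedge _)]ext_map_wedge fmap_fcons
  [Omega_map phi (wedge f)]ext_map_wedge wedgel_wedge.
Qed.

Lemma Omega1_map_aug_inj w :
  Omega1_map (@dual_aug R) (Omega1_map (@dual_inj R) w) = w.
Proof.
elim/Omega1_ind: w => [|a b x IH]; first by rewrite !linear0.
rewrite [Omega1_map (@dual_inj R) _]linearP [LHS]linearP /= IH.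
by rewrite !Omega1_map_kd.
Qed.

Lemma Omega1_map_aug_eps : Omega1_map (@dual_aug R) (kd (eps R)) = 0.
Proof. by rewrite Omega1_map_kd /= kd0. Qed.

Lemma Omega_map_aug_inj n (x : Omega n R) : Omega_map (@dual_aug R) (inj x) = x.
Proof.
elim/ext_ind: x => [|a f x IH]; first by rewrite !linear0.
rewrite [inj _]linearP [LHS]linearP /= IH.
rewrite [inj (wedge f)]ext_map_wedge [Omega_map _ (wedge _)]ext_map_wedge.
congr (_ *: wedge _ + _); apply/ffunP => i.
by rewrite !ffunE; apply: Omega1_map_aug_inj.
Qed.

Lemma dual_im_derivation :
  derivation_for (@dual_aug R) (fun x => dual_im x : R^o).
Proof. by []. Qed.

(* (x + y eps) d(u + v eps) |-> x v *)
Definition deps_coef : Omega1 (dual R) -> R^o := kahler_lift dual_im_derivation.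
HB.instance Definition _ := GRing.Linear.on deps_coef.

Definition contr_eps n : Omega n.+1 (dual R) -> Omega n R :=
  @contr _ _ _ _ _ (Omega1_map (@dual_aug R)) deps_coef n.
HB.instance Definition _ n := GRing.Linear.on (@contr_eps n).

Lemma contr_eps_form n a b c : contr_eps (tangent_form a b c) = b :> Omega n R.
Proof.
have CD x y : contr_eps (x + y) = contr_eps x + contr_eps y :> Omega n R.
  exact: linearD.
have CZ x : contr_eps (eps R *: x) = 0 :> Omega n R.
  by rewrite linearZ /= scale0r.
rewrite !CD !CZ add0r addr0 [LHS]contr_wedgel; last exact: Omega1_map_aug_eps.
have lE : deps_coef (kd (eps R)) = 1 by exact: kahler_lift_kd.
by rewrite /= lE scale1r; apply: Omega_map_aug_inj.
Qed.

Inductive dual_gens : forall n, Omega n (dual R) -> Prop :=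
| dual_gens_inj n (a : Omega n R) : dual_gens (inj a)
| dual_gens_deps n (b : Omega n R) : dual_gens (deps (inj b)).

Lemma spanned_wedgel n w (x : Omega n (dual R)) :
  spanned (@dual_gens n) x -> spanned (@dual_gens n.+1) (wedgel w x).
Proof.
elim=> [|{}x xg|a u v _ IHu _ IHv]; first by rewrite wedgel0; apply: spanned0.
  2: by rewrite wedgelD wedgelZ; apply: spanned_comb.
elim/Omega1_ind: w => [|s r w IH]; first by rewrite wedgelw0; apply: spanned0.
rewrite wedgelwD wedgelwZ; apply: spanned_comb => {IH} //.
have inj_kd t m (y : Omega m R) :
  wedgel (kd (dual_inj t)) (inj y) = inj (wedgel (kd t) y).
  by rewrite Omega_map_wedgel Omega1_map_kd.
have Hinj t : spanned (@dual_gens n.+1) (wedgel (kd (dual_inj t)) x).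
  case: n x / xg => n y.
    by rewrite inj_kd; apply/spanned_gen/dual_gens_inj.
  rewrite wedgelC inj_kd.
  by apply/spannedN/spanned_gen/dual_gens_deps.
have Heps : spanned (@dual_gens n.+1) (deps x).
  case: n x / xg {Hinj} => n y; first exact/spanned_gen/dual_gens_deps.
  by rewrite wedgelww; apply: spanned0.
rewrite kd_dual !wedgelwD !wedgelwZ.
by apply: spannedD; [apply: spannedD|] => //; apply: spannedZ.
Qed.

Lemma dual_spanned n (x : Omega n (dual R)) : spanned (@dual_gens n) x.
Proof.
elim/ext_ind: x => [|a f x IH]; first exact: spanned0.
apply: spanned_comb => // {x IH}.
elim: n f => [|n IH] f.
  apply: spanned_gen.
  have -> : wedge f = inj (wedge [ffun i : 'I_0 => 0]).
    rewrite [RHS]ext_map_wedge; congr wedge.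
    by apply/ffunP; case.
  exact: dual_gens_inj.
by rewrite [f]fconsE -wedgel_wedge; apply: spanned_wedgel.
Qed.

Lemma tangent_scale (D : comPzRingType) (U : lmodType D) (e s s0 s1 : D)
    (A0 A1 B C : U) : s = s0 + e * s1 -> e * e = 0 ->
  s *: (A0 + (e *: A1 + B + e *: C)) =
  s0 *: A0 + (e *: (s1 *: A0 + s0 *: A1) + s0 *: B + e *: (s1 *: B + s0 *: C)).
Proof.
move=> sE ee0.
have se X : s *: (e *: X) = e *: (s0 *: X) :> U.
  by rewrite !scalerA sE mulrDl mulrAC ee0 mul0r addr0 mulrC.
have sX X : s *: X = s0 *: X + e *: (s1 *: X) :> U.
  by rewrite sE scalerDl scalerA.
rewrite !scalerDr !se !sX -!addrA.
by congr (_ + (_ + (_ + (_ + _)))).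
Qed.

Lemma tangent_form0 n : tangent_form (n:=n) 0 0 0 = 0.
Proof. by rewrite /tangent_form !linear0 ?wedgel0 ?scaler0 !addr0. Qed.

Lemma dual_gens_form m (x : Omega m (dual R)) : dual_gens x ->
  match m return Omega m (dual R) -> Prop with
  | 0 => fun=> True
  | n.+1 => fun y => exists a0 a b c, y = inj a0 + tangent_form (n:=n) a b c
  end x.
Proof.
case=> [[//|n] a|n b]; first by exists a, 0, 0, 0; rewrite tangent_form0 addr0.
exists 0, 0, b, 0.
by rewrite /tangent_form !linear0 ?wedgel0 ?scaler0 !add0r addr0.
Qed.

Lemma dual_form n (x : Omega n.+1 (dual R)) :
  exists a0 a b c, x = inj a0 + tangent_form a b c.
Proof.
have HD y z : (exists a0 a b c, y = inj a0 + tangent_form (n:=n) a b c) ->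
    (exists a0 a b c, z = inj a0 + tangent_form (n:=n) a b c) ->
    exists a0 a b c, y + z = inj a0 + tangent_form (n:=n) a b c.
  move=> [a0 [a [b [c ->]]]] [a0' [a' [b' [c' ->]]]].
  exists (a0 + a0'), (a + a'), (b + b'), (c + c').
  rewrite addrACA; congr (_ + _); first by rewrite linearD.
  rewrite /tangent_form ![inj (_ + _)]linearD !wedgelD !scalerDr.
  by rewrite [LHS]addrACA; congr (_ + _); rewrite addrACA.
elim: (dual_spanned x) => [|{}x xg|s u v _ IHu _ IHv].
- by exists 0, 0, 0, 0; rewrite tangent_form0 linear0 addr0.
- exact: dual_gens_form xg.
apply: HD => //; case: IHu => [a0 [a [b [c ->]]]].
exists (dual_re s *: a0), (dual_im s *: a0 + dual_re s *: a), (dual_re s *: b),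
  (dual_im s *: b + dual_re s *: c).
have iP m t (y z : Omega m R) : inj (t *: y + z) = dual_inj t *: inj y + inj z.
  by rewrite linearP.
have iZ m t (y : Omega m R) : inj (t *: y) = dual_inj t *: inj y.
  by rewrite linearZ.
have dP y z : deps (inj (dual_im s *: y + dual_re s *: z)) =
    dual_inj (dual_im s) *: deps (inj y) + dual_inj (dual_re s) *: deps (inj z)
    :> Omega n.+1 _.
  by rewrite iP iZ wedgelD !wedgelZ.
have dZ y : deps (inj (dual_re s *: y)) =
    dual_inj (dual_re s) *: deps (inj y) :> Omega n.+1 _.
  by rewrite iZ wedgelZ.
rewrite /tangent_form dP dZ iP !iZ.
exact: tangent_scale (dualE s) (eps_sqr R).
Qed.

Lemma TOmega_form n (x : TOmega n.+1 R) :
  exists b a c, val x = tangent_form a b c.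
Proof.
case: (dual_form (val x)) => a0 [a [b [c xE]]]; exists b, a, c.
suff a00 : a0 = 0 by rewrite xE a00 linear0 add0r.
have aug0 m (y : Omega m.+1 (dual R)) : Omega_map (@dual_aug R) (eps R *: y) = 0.
  by rewrite linearZ /= scale0r.
have augD m (y z : Omega m (dual R)) : Omega_map (@dual_aug R) (y + z) =
  Omega_map (@dual_aug R) y + Omega_map (@dual_aug R) z by rewrite linearD.
have : Omega_map (@dual_aug R) (val x) = 0 by exact: kernelP.
rewrite xE /tangent_form !augD !aug0 Omega_map_wedgel Omega1_map_aug_eps.
by rewrite wedgelw0 Omega_map_aug_inj !addr0.
Qed.

(* The component b of x = eps a + deps /\ b + eps deps /\ c: it exists by
   TOmega_form and is unique by proj_depsP. *)
Definition proj_deps n (x : TOmega n.+1 R) : Omega n R :=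
  projT1 (cid (TOmega_form x)).

Lemma proj_depsP n (x : TOmega n.+1 R) a b c :
  val x = tangent_form a b c -> proj_deps x = b.
Proof.
move=> xE; rewrite /proj_deps; case: cid => b' [a' [c']] /=.
by rewrite xE => /(congr1 (@contr_eps n)); rewrite !contr_eps_form.
Qed.

Lemma proj_depsE n (x : TOmega n.+1 R) : proj_deps x = contr_eps (val x).
Proof.
by case: (TOmega_form x) => b [a [c xE]]; rewrite (proj_depsP xE) xE contr_eps_form.
Qed.

Lemma proj_deps_is_zmod_morphism n : zmod_morphism (@proj_deps n).
Proof.
move=> x y; rewrite !proj_depsE; exact: linearB.
Qed.
HB.instance Definition _ n := GRing.isZmodMorphism.Build (TOmega n.+1 R)
  (Omega n R) (@proj_deps n) (@proj_deps_is_zmod_morphism n).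
End Decomposition.

Definition Bmap (n : nat) (R : comPzRingType) :
    {additive TmilnorK n.+1 R -> Omega n R} :=
  (@proj_deps R n \o @Tdlog n.+1 R)%FUN.

Definition weakly_stable (k : nat) (R : comPzRingType) :=
  forall r : 'I_k.-1 -> R, exists2 u : R, is_unit u & forall i, is_unit (r i + u).

(* Main.v *)
From HB Require Import structures.
From mathcomp Require Import all_boot all_algebra.
From mathcomp Require Import ring boolp.
Require Import Defs.

Set Implicit Arguments.
Unset Strict Implicit.
Unset Printing Implicit Defensive.

Import GRing.Theory.
Local Open Scope ring_scope.

(** The inverse of B should send [a du_1/u_1 /\ .. /\ du_n/u_n], for units
    [u_i] of [R], to the symbol [{u_1, .., u_n, 1 + a eps}], up to the sign
    [(-1)^n] of moving [d eps] to the front. Two things have to be shown: that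
    such symbols generate the tangent space [T_n] of [K_{n+1}], and that the
    assignment respects the relations between differential forms.

    Both rest on identities in [K_2] of the dual numbers. Every one of them is
    a property of the pairing [(u, v) |-> {u} {v} x] with [x] fixed, so they
    are proved for arbitrary biadditive pairings [beta] on units that satisfy
    the Steinberg relation.
    - Weak 5-fold stability gives anticommutativity ([pairing_skew]).
    - The Steinberg relation at [u + c u v eps] with [u + v = 1] equates a term
      additive in [c] and a term quadratic in [c]. As the polar form of the
      latter vanishes, [{1 + c eps, 1 + d eps}] depends only on [c d]; being
      antisymmetric, it is zero when 2 is invertible ([pairing_tunit]).
    - What is left of that relation says that [u |-> {u, 1 + u c eps}] is
      additive in [u] whenever this makes sense ([pairing_additive]).

    By the first two facts, the symbols above generate [T_n]
    ([in_tangent_sub_inj]). Substituting [a eps] for [eps] makes [R] act on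
    [T_n]; on generators this action is additive in [a], so [T_n] is an
    [R]-module. For [x] in [T_n], the third fact says that
    [u |-> u . ({u} x)] is additive on units of [R]. Every element of [R] is a
    difference of units, so this map extends to [R] ([additive_ext]) and the
    extension is a derivation ([tder_derivation]). The universal property of
    differentials then yields a product [tmul] of a 1-form with [x]. It is
    anticommutative, with squares zero because 2 is invertible, so iterating it
    on [{1 + eps}] gives an alternating map, hence a linear map [Binv] from
    [n]-forms to [T_n]. It is surjective because it reaches the generators
    ([Binv_surj]), and B composed with it is [(-1)^n] ([BmapK]). *)

(** * Units and weak stability *)

Section UnitGroup.
Variable R : comPzRingType.
Implicit Types (a b : R) (u v w : units R).

Lemma is_unitP a : is_unit a -> exists u, uval u = a.
Proof. by case=> b ab; exists (mk_units ab). Qed.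

Lemma is_unit_uval u : is_unit (uval u).
Proof. by exists (uinv u); apply: uvalK. Qed.

Lemma is_unitM a b : is_unit a -> is_unit b -> is_unit (a * b).
Proof. by case=> c ac [d bd]; exists (c * d); rewrite mulrACA ac bd mulr1. Qed.

Lemma is_unitN a : is_unit a -> is_unit (- a).
Proof. by case=> b ab; exists (- b); rewrite mulrNN. Qed.

(** Units form an additive group, in which [- u] is the inverse of [u]; the ring
    opposite of [u] is the unit [u + unit_opp1]. *)
Definition unit_opp1 : units R := mk_units (etrans (mulrNN 1 1) (mulr1 1)).

Hypothesis stab : weakly_stable 5 R.

Lemma unit_translate4 a b c d : exists u, [/\ is_unit (a + uval u),
  is_unit (b + uval u), is_unit (c + uval u) & is_unit (d + uval u)].
Proof.
have [x /is_unitP[u <-] H] := stab (fun i : 'I_4 => nth 0 [:: a; b; c; d] i).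
exists u; split.
- exact: (H (@Ordinal 4 0 isT)).
- exact: (H (@Ordinal 4 1 isT)).
- exact: (H (@Ordinal 4 2 isT)).
- exact: (H (@Ordinal 4 3 isT)).
Qed.
End UnitGroup.

(** * Steinberg pairings *)

Section SteinbergPairing.
Variables (A : comPzRingType) (W : zmodType) (beta : units A -> units A -> W).
Hypothesis stab : weakly_stable 5 A.
Hypothesis betaDl : forall u v w, beta (u + v) w = beta u w + beta v w.
Hypothesis betaDr : forall u v w, beta u (v + w) = beta u v + beta u w.
Hypothesis steinberg : forall u v, uval u + uval v = 1 -> beta u v = 0.
Local Notation m1 := (unit_opp1 A).

Lemma pairing0l u : beta 0 u = 0.
Proof. by apply: (addrI (beta 0 u)); rewrite -betaDl !addr0. Qed.
Lemma pairing0r u : beta u 0 = 0.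
Proof. by apply: (addrI (beta u 0)); rewrite -betaDr !addr0. Qed.
Lemma pairingNl u v : beta (- u) v = - beta u v.
Proof. by apply/eqP; rewrite -addr_eq0 -betaDl addNr pairing0l. Qed.
Lemma pairingNr u v : beta u (- v) = - beta u v.
Proof. by apply/eqP; rewrite -addr_eq0 -betaDr addNr pairing0r. Qed.

(** Since [- u = (1 - u) / (1 - u^-1)], the value is
    [beta u (1 - u) + beta (u^-1) (1 - u^-1)], a sum of two Steinberg terms. *)
Lemma pairing_opp_generic u : is_unit (1 - uval u) -> beta u (u + m1) = 0.
Proof.
case/is_unitP=> w wE.
have zE : uval (w - (u + m1)) = 1 - uinv u.
  rewrite uvalD (_ : uval (- (u + m1)) = - uinv u).
    by rewrite wE mulrBl mul1r mulrN uvalK opprK addrC.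
  exact: mulrN1.
have -> : u + m1 = w - (w - (u + m1)) by rewrite opprB addrCA subrr addr0.
rewrite betaDr steinberg; last by rewrite wE; ring.
rewrite add0r pairingNr -pairingNl steinberg // zE.
by rewrite addrC subrK.
Qed.

Lemma pairing_oppD u v : beta (u + v) (u + v + m1) =
  beta u (u + m1) + beta v (v + m1) + (beta u v + beta v u).
Proof.
rewrite betaDl {1}(addrAC u) (addrC u v) (addrAC v) [beta u (_ + v)]betaDr.
by rewrite [beta v (_ + u)]betaDr addrACA.
Qed.

(** Let [q u] be [beta u (- u)]. Then [sym u s], the failure of additivity
    [q (u s) - q u - q s], is additive in [s]. If [1 - s] and [1 - u s] are
    units then [q s] and [q (u s)] vanish, so [sym u s = - q u]. Taking two such
    units [s] and [t] whose product is of the same kind gives [- q u = - 2 q u].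
    The choice of [t] is what uses the full strength of the hypothesis. *)
Lemma pairing_opp u : beta u (u + m1) = 0.
Proof.
pose q v := beta v (v + m1); pose sym v w := beta v w + beta w v.
have qD v w : q (v + w) = q v + q w + sym v w by exact: pairing_oppD.
pose good s := q s = 0 /\ q (u + s) = 0.
have goodE s : is_unit (uval s - 1) -> is_unit (uval s - uinv u) -> good s.
  move=> s1 su; split; apply: pairing_opp_generic.
    by rewrite -opprB; apply: is_unitN.
  have -> : 1 - uval (u + s) = - (uval u * (uval s - uinv u)).
    by rewrite uvalD mulrBr uvalK opprB.
  exact/is_unitN/is_unitM/su/is_unit_uval.
have good_sym s : good s -> sym u s = - q u.
  by case=> qs; rewrite qD qs addr0 addrC => /eqP; rewrite addr_eq0 => /eqP.
have [s [s1 su _ _]] := unit_translate4 stab (- 1) (- uinv u) 0 0.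
have [t [t1 tu ts tus]] := unit_translate4 stab (- 1) (- uinv u) (- uinv s)
  (- (uinv u * uinv s)).
rewrite ![- _ + _]addrC in s1 su t1 tu ts tus.
have gst : good (s + t).
  apply: goodE; rewrite uvalD.
    have -> : uval s * uval t - 1 = uval s * (uval t - uinv s).
      by rewrite mulrBr uvalK.
    exact/is_unitM/ts/is_unit_uval.
  have -> : uval s * uval t - uinv u = uval s * (uval t - uinv u * uinv s).
    by rewrite mulrBr mulrCA uvalK mulr1.
  exact/is_unitM/tus/is_unit_uval.
have := good_sym _ gst.
have -> : sym u (s + t) = sym u s + sym u t.
  by rewrite /sym betaDl betaDr addrACA.
rewrite (good_sym _ (goodE _ s1 su)) (good_sym _ (goodE _ t1 tu)).
by rewrite -[RHS]addr0 => /addrI /eqP; rewrite oppr_eq0 => /eqP.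
Qed.

Lemma pairing_skew u v : beta u v = - beta v u.
Proof.
apply/eqP; rewrite -addr_eq0; apply/eqP.
by have := pairing_oppD u v; rewrite !pairing_opp !add0r.
Qed.
End SteinbergPairing.

(** * Additive extension from units *)

Section AdditiveExtension.
Variables (R : comPzRingType) (W : zmodType).
Hypothesis stab : weakly_stable 5 R.

Lemma unit_difference (a : R) : exists u v : units R, a = uval u - uval v.
Proof.
have [v [/is_unitP[u uE] _ _ _]] := unit_translate4 stab a 0 0 0.
by exists u, v; rewrite uE addrK.
Qed.

Lemma additive_ext_eq (f g : R -> W) :
  {morph f : a b / a + b} -> {morph g : a b / a + b} ->
  (forall u : units R, f (uval u) = g (uval u)) -> forall a, f a = g a.
Proof.
move=> fD gD fg a; have [u [v ->]] := unit_difference a.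
by apply: (addIr (f (uval v))); rewrite -fD subrK fg fg -gD subrK.
Qed.

Variable D : units R -> W.
Hypothesis DD : forall u v w, uval u + uval v = uval w -> D u + D v = D w.

Definition unit_near (a : R) :
  {p : units R * units R | a + uval p.1 = uval p.2}.
Proof.
apply/cid; have [u [v avu]] := unit_difference a.
by exists (v, u); rewrite avu subrK.
Qed.

Definition additive_ext (a : R) : W :=
  D (sval (unit_near a)).2 - D (sval (unit_near a)).1.

(** The choice of [u] does not matter: if [v = a + u] and [v' = a + u'], then
    for a unit [w] in general position [D v + D (u' + w)] and
    [D v' + D (u + w)] are both [D (a + u + u' + w)]. *)
Lemma additive_extE a u v : a + uval u = uval v -> additive_ext a = D v - D u.
Proof.
rewrite /additive_ext; case: unit_near => [[u' v']] /= auv' auv.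
have [w [/is_unitP[x xE] /is_unitP[y yE] /is_unitP[z zE] _]] :=
  unit_translate4 stab (uval u) (uval u') (uval u + uval v') 0.
have Hv' : D v' + D x = D z by apply: DD; rewrite xE zE -auv'; ring.
have Hv : D v + D y = D z by apply: DD; rewrite yE zE -auv -auv'; ring.
have Hx : D u + D w = D x by apply: DD; rewrite xE.
have Hy : D u' + D w = D y by apply: DD; rewrite yE.
apply/eqP; rewrite subr_eq addrAC eq_sym subr_eq; apply/eqP.
apply: (addIr (D w)); rewrite -addrA Hy -addrA Hx.
by rewrite Hv Hv'.
Qed.

Lemma additive_ext_unit u : additive_ext (uval u) = D u.
Proof.
have [v [/is_unitP[w wE] _ _ _]] := unit_translate4 stab (uval u) 0 0 0.
by rewrite (additive_extE (esym wE)) -(DD (esym wE)) addrK.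
Qed.

Lemma additive_extD : {morph additive_ext : a b / a + b}.
Proof.
move=> a b; have [u [/is_unitP[u' uE] _ _ _]] := unit_translate4 stab a 0 0 0.
have [v [/is_unitP[v' vE] /is_unitP[w wE] /is_unitP[w' wE'] _]] :=
  unit_translate4 stab b (uval u) (a + b + uval u) 0.
rewrite (additive_extE (esym uE)) (additive_extE (esym vE)).
rewrite (@additive_extE _ w w'); last by rewrite wE wE' addrA.
rewrite -(DD (esym wE)) -(@DD u' v' w'); last by rewrite uE vE wE'; ring.
by rewrite opprD addrACA.
Qed.
End AdditiveExtension.

(** * Steinberg pairings on dual numbers *)

Section DualUnits.
Variable R : comPzRingType.
Implicit Types (c d : R) (u v w : units R).

(** The units of [R[eps]] are the products of a constant unit, [cunit], and a
    unit tangent to 1, [tunit]. *)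
Definition cunit u : units (dual R) := units_map (@dual_inj R) u.

Lemma cunitD u v : cunit (u + v) = cunit u + cunit v.
Proof. by apply: uval_inj; apply: rmorphM. Qed.

Lemma tunit_subproof c : Dual 1 c * Dual 1 (- c) = 1.
Proof. by apply: dual_eq => /=; ring. Qed.
Definition tunit c : units (dual R) := mk_units (tunit_subproof c).

Lemma tunitD c d : tunit (c + d) = tunit c + tunit d.
Proof. by apply: uval_inj; apply: dual_eq => /=; ring. Qed.

Lemma tunit0 : tunit 0 = 0.
Proof. by apply: (addrI (tunit 0)); rewrite -tunitD !addr0. Qed.

Lemma dual_unit_split (x : units (dual R)) :
  exists u c, x = cunit u + tunit c.
Proof.
exists (units_map (@dual_aug R) x).
exists (uinv (units_map (@dual_aug R) x) * dual_im (uval x)).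
apply: uval_inj; apply: dual_eq; rewrite /= ?mulr1 //.
by rewrite mulr0 addr0 mulrA uvalK mul1r.
Qed.

Lemma dual_unitP (x : dual R) : is_unit (dual_re x) -> is_unit x.
Proof.
case: x => a b /= [c ac]; exists (Dual c (- (c * c * b))).
apply: dual_eq => //=; rewrite mulrN mulrA mulrA ac mul1r mulrC.
by rewrite addNr.
Qed.

Lemma dual_stable k : weakly_stable k R -> weakly_stable k (dual R).
Proof.
move=> stab r; have [u uU rU] := stab (fun i => dual_re (r i)).
exists (dual_inj u); first exact: dual_unitP.
by move=> i; apply: dual_unitP; apply: rU.
Qed.
End DualUnits.

Section DualPairing.
Variables (R : comPzRingType) (W : zmodType).
Variable beta : units (dual R) -> units (dual R) -> W.
Hypotheses (half : is_unit (2%:R : R)) (stab : weakly_stable 5 R).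
Hypothesis betaDl : forall u v w, beta (u + v) w = beta u w + beta v w.
Hypothesis betaDr : forall u v w, beta u (v + w) = beta u v + beta u w.
Hypothesis steinberg : forall u v, uval u + uval v = 1 -> beta u v = 0.
Implicit Types (c d : R) (u v w : units R).

Let skew := pairing_skew (dual_stable stab) betaDl betaDr steinberg.
Local Notation br c d := (beta (tunit c) (tunit d)).
Local Notation an c u := (beta (tunit c) (cunit u)).

Lemma half_sum c : exists d, c = d + d.
Proof.
case: half => h hE; exists (h * c).
by rewrite -mulrDl -[h]mul1r -mulrDl -mulr2n hE mul1r.
Qed.

Lemma tunit_pairingDl c c' d : br (c + c') d = br c d + br c' d.
Proof. by rewrite tunitD betaDl. Qed.
Lemma tunit_pairingDr c d d' : br c (d + d') = br c d + br c d'.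
Proof. by rewrite tunitD betaDr. Qed.

(** The Steinberg relation for [u (1 + v c eps)] and [v (1 - u c eps)], whose
    sum is [u + v = 1]. *)
Lemma pairing_steinberg_eps u v c : uval u + uval v = 1 ->
  an (uval u * c) u + an (uval v * c) v = br (uval v * c) (uval u * c).
Proof.
move=> uv1.
have uv0 : beta (cunit u) (cunit v) = 0.
  by apply: steinberg; apply: dual_eq; rewrite /= ?uv1 ?addr0.
have : beta (cunit u + tunit (uval v * c))
            (cunit v + tunit (- (uval u * c))) = 0.
  apply: steinberg; apply: dual_eq; rewrite /= ?mulr1 // !mulr0 !addr0.
  by ring.
have tN d : tunit (- d) = - tunit d.
  by apply/eqP; rewrite -addr_eq0 -tunitD addNr tunit0.
rewrite betaDl !betaDr uv0 add0r tN !(pairingNr betaDr).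
rewrite [beta (cunit u) _]skew opprK => /eqP.
by rewrite addrA subr_eq0 => /eqP.
Qed.

(** The left side of [pairing_steinberg_eps] is additive in [c], hence so is its
    right side; being quadratic in [c], the latter has zero polar form. *)
Lemma tunit_pairing_polar u v c d : uval u + uval v = 1 ->
  br (uval v * c) (uval u * d) + br (uval v * d) (uval u * c) = 0.
Proof.
move=> uv1; pose L c := an (uval u * c) u + an (uval v * c) v.
have LD x y : L (x + y) = L x + L y.
  by rewrite /L !mulrDr !tunitD !betaDl addrACA.
have := LD c d; rewrite /L !pairing_steinberg_eps // !mulrDr.
rewrite !tunit_pairingDl !tunit_pairingDr.
set a := br _ _; set b := br _ _; set e := br _ _; set f := br _ _.
by rewrite [e + f]addrC addrACA -[RHS]addr0 => /addrI.
Qed.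

(** For [x] such that [x] and [1 - x] are units, this is [tunit_pairing_polar]
    rewritten by anticommutativity. Weak stability provides enough such [x] to
    generate [R] additively. *)
Lemma tunit_pairing_balanced c d x : br (x * c) d = br c (x * d).
Proof.
have brNl y z : br (- y) z = - br y z.
  by apply/eqP; rewrite -addr_eq0 -tunit_pairingDl addNr tunit0 pairing0l.
have brNr y z : br y (- z) = - br y z.
  by apply/eqP; rewrite -addr_eq0 -tunit_pairingDr addNr tunit0 pairing0r.
have gen u : is_unit (uval u - 1) -> br (uval u * c) d = br c (uval u * d).
  move=> /is_unitN; rewrite opprB => /is_unitP[v vE].
  have := @tunit_pairing_polar u v c d; rewrite vE addrCA subrr addr0.
  move=> /(_ erefl); rewrite [X in _ + X]skew => /eqP; rewrite subr_eq0 => /eqP.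
  rewrite !mulrBl !mul1r !(tunit_pairingDl, tunit_pairingDr, brNl, brNr).
  by move=> /addIr.
have [v [/is_unitP[u uE] vU xvU _]] := unit_translate4 stab x (- 1) (x - 1) 0.
have -> : x = uval u - uval v by rewrite uE addrK.
rewrite !mulrBl tunit_pairingDl tunit_pairingDr brNl brNr !gen //.
  by rewrite addrC.
by rewrite uE addrAC.
Qed.

(** Since [br c d = br 1 (c * d)], this pairing is symmetric; it is also
    antisymmetric, and [d] is divisible by 2. *)
Lemma pairing_tunit c d : br c d = 0.
Proof.
have br2 x y : br x y + br x y = 0.
  have br1 a b : br a b = br 1 (a * b).
    by rewrite -[in LHS](mulr1 a) tunit_pairing_balanced.
  by rewrite {2}skew (br1 x) (br1 y) mulrC subrr.
by have [e ->] := half_sum d; rewrite tunit_pairingDr br2.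
Qed.

(** This is [pairing_steinberg_eps] at [u / w] and [v / w], whose right side
    vanishes. It is the relation [du + dv = d(u + v)] in symbols. *)
Lemma pairing_additive u v w c : uval u + uval v = uval w ->
  beta (cunit u) (tunit (uval u * c)) + beta (cunit v) (tunit (uval v * c)) =
  beta (cunit w) (tunit (uval w * c)).
Proof.
move=> uvw; have cD x y : cunit (x - y) = cunit x - cunit y.
  by apply/eqP; rewrite eq_sym subr_eq -cunitD subrK.
have : an (uval (u - w) * (uval w * c)) (u - w) +
       an (uval (v - w) * (uval w * c)) (v - w) = 0.
  rewrite pairing_steinberg_eps ?pairing_tunit //.
  by rewrite !uvalD -mulrDl uvw uvalK.
have uwE x : uval (x - w) * (uval w * c) = uval x * c.
  by rewrite mulrA -uvalD subrK.
rewrite !uwE !cD !betaDr !(pairingNr betaDr) addrACA -opprD -betaDl -tunitD.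
rewrite -mulrDl uvw => /eqP; rewrite subr_eq0 => /eqP H.
by rewrite ![beta (cunit _) _]skew -H opprD.
Qed.
End DualPairing.

(** * Left multiplication by a unit in Milnor K-theory *)

Section LeftMultiplication.
Variable R : comPzRingType.
Implicit Types (u v : units R) (n : nat).

Section Def.
Variables (n : nat) (u : zmodule (units R)).

Lemma cupl_multilinear : multilinear_for idfun
  (fun f : {ffun 'I_n -> zmodule (units R)} => symbol (fcons u f)).
Proof.
case: (symbol_multilinear n.+1 R) => sD sZ.
by split=> [f i x y|f i a x]; rewrite -!upd_fconsS ?sD ?sZ.
Qed.

Lemma cupl_steinberg_fcons (f : {ffun 'I_n -> zmodule (units R)}) (i j : 'I_n) :
  j = i.+1 :> nat -> uval (f j) = 1 - uval (f i) -> symbol (fcons u f) = 0.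
Proof.
move=> ij fij; apply: (@symbol_steinberg _ _ _ (lift ord0 i) (lift ord0 j)).
  by rewrite !lift0 ij.
by rewrite !fconsS.
Qed.

Definition cupl : milnorK n R -> milnorK n.+1 R :=
  milnorK_lift cupl_multilinear cupl_steinberg_fcons.
HB.instance Definition _ := GRing.Linear.on cupl.

Lemma cupl_symbol f : cupl (symbol f) = symbol (fcons u f).
Proof. exact: milnorK_lift_symbol. Qed.
Lemma cuplP a x y : cupl (a *: x + y) = a *: cupl x + cupl y.
Proof. exact: linearP. Qed.
Lemma cuplD x y : cupl (x + y) = cupl x + cupl y.
Proof. exact: linearD. Qed.
Lemma cuplB x y : cupl (x - y) = cupl x - cupl y.
Proof. exact: linearB. Qed.
Lemma cupl0 : cupl 0 = 0.
Proof. exact: linear0. Qed.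
End Def.

Lemma cupl_unitD n u v (x : milnorK n R) : cupl (u + v) x = cupl u x + cupl v x.
Proof.
elim/milnorK_ind: x => [|a f x IH]; first by rewrite !cupl0 addr0.
rewrite !cuplP !cupl_symbol IH addrACA -scalerDr.
congr (_ *: _ + _); case: (symbol_multilinear n.+1 R) => sD _.
by rewrite -(upd_fcons0 0 f (u + v)) sD !upd_fcons0.
Qed.

Lemma cupl_unit0 n (x : milnorK n R) : cupl 0 x = 0.
Proof. by apply: (addrI (cupl 0 x)); rewrite -cupl_unitD !addr0. Qed.

Lemma cupl_steinberg n u v (x : milnorK n R) :
  uval u + uval v = 1 -> cupl u (cupl v x) = 0.
Proof.
move=> uv; elim/milnorK_ind: x => [|a f x IH]; first by rewrite !cupl0.
rewrite cuplP cuplP IH addr0 !cupl_symbol.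
rewrite (@symbol_steinberg _ _ _ ord0 (lift ord0 ord0)) ?scaler0 //.
by rewrite fconsS !fcons0 -uv addrC addKr.
Qed.

Lemma cupl_skew n u v (x : milnorK n R) : weakly_stable 5 R ->
  cupl u (cupl v x) = - cupl v (cupl u x).
Proof.
move=> stab; apply: (pairing_skew (beta := fun u v => cupl u (cupl v x)) stab).
- by move=> ? ? ?; apply: cupl_unitD.
- by move=> ? ? ?; rewrite cupl_unitD cuplD.
- by move=> ? ?; apply: cupl_steinberg.
Qed.

Definition symbol_nil : milnorK 0 R := symbol [ffun=> 0].

Lemma symbol_nilE f : symbol f = symbol_nil.
Proof. by congr symbol; apply/ffunP; case. Qed.

(** Induction over the degree: a symbol is obtained from the empty one by left
    multiplications, so identities need only be checked against [cupl]. *)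
Lemma milnorK_cupl_ind (P : forall n, milnorK n R -> Prop) :
  (forall n x y, P n x -> P n y -> P n (x - y)) -> (forall n, P n 0) ->
  P 0 symbol_nil -> (forall n u x, P n x -> P n.+1 (cupl u x)) ->
  forall n x, P n x.
Proof.
move=> PB P0 P1 PS n x.
have PN y : P n y -> P n (- y) by move=> Py; rewrite -sub0r; apply: PB.
elim/milnorK_ind: x => [//|a f x Px].
have Pf : P n (symbol f).
  elim: n f {x Px PN} => [|n IH] f; first by rewrite symbol_nilE.
  by rewrite [f]fconsE -cupl_symbol; apply: PS.
have PM k : P n (symbol f *+ k).
  elim: k => [|k IH]; first by rewrite mulr0n.
  by rewrite mulrSr -[X in _ + X]opprK; apply: PB => //; apply: PN.
rewrite addrC -[_ *: _]opprK; apply: PB => //; rewrite -scaleNr.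
case: (- a) => k; first by rewrite -natz scaler_nat.
by rewrite NegzE scaleNr -natz scaler_nat; apply: PN.
Qed.
End LeftMultiplication.

Section MilnorMaps.
Variables (R R' : comPzRingType) (phi : {rmorphism R -> R'}).

Lemma milnorK_map_cupl n u (x : milnorK n R) :
  milnorK_map phi (cupl u x) = cupl (units_map phi u) (milnorK_map phi x).
Proof.
have mP m a (y z : milnorK m R) :
  milnorK_map phi (a *: y + z) = a *: milnorK_map phi y + milnorK_map phi z.
  by rewrite linearP.
elim/milnorK_ind: x => [|a f x IH]; first by rewrite cupl0 !linear0.
rewrite cuplP !mP cuplP IH cupl_symbol !milnorK_map_symbol cupl_symbol.
congr (_ *: symbol _ + _).
by apply: (fmap_fcons (units_map phi)).
Qed.

Lemma milnorK_map_nil : milnorK_map phi (symbol_nil R) = symbol_nil R'.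
Proof. by rewrite milnorK_map_symbol symbol_nilE. Qed.

Lemma milnorK_mapB n (x y : milnorK n R) :
  milnorK_map phi (x - y) = milnorK_map phi x - milnorK_map phi y.
Proof. exact: linearB. Qed.
Lemma milnorK_map0 n : milnorK_map phi (0 : milnorK n R) = 0.
Proof. exact: linear0. Qed.
End MilnorMaps.

Lemma milnorK_map_comp (R1 R2 R3 : comPzRingType) (phi : {rmorphism R1 -> R2})
    (psi : {rmorphism R2 -> R3}) (chi : {rmorphism R1 -> R3}) n
    (x : milnorK n R1) :
  psi \o phi =1 chi -> milnorK_map psi (milnorK_map phi x) = milnorK_map chi x.
Proof.
move=> E; elim/milnorK_cupl_ind: n / x => [n x y IHx IHy|n||n u x IH].
- by rewrite !milnorK_mapB IHx IHy.
- by rewrite !linear0.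
- by rewrite !milnorK_map_nil.
rewrite !milnorK_map_cupl IH; congr cupl.
by apply: uval_inj; apply: E.
Qed.

Lemma milnorK_map_id (R : comPzRingType) (phi : {rmorphism R -> R}) n
    (x : milnorK n R) : phi =1 id -> milnorK_map phi x = x.
Proof.
move=> E; elim/milnorK_cupl_ind: n / x => [n x y IHx IHy|n||n u x IH].
- by rewrite milnorK_mapB IHx IHy.
- by rewrite linear0.
- by rewrite milnorK_map_nil.
rewrite milnorK_map_cupl IH; congr cupl.
by apply: uval_inj; apply: E.
Qed.

(** * Generators of the tangent space *)

Section ScaleEps.
Variable R : comPzRingType.
Implicit Types (a b c : R) (u : units R).

(** The substitution of [a eps] for [eps]; it induces the action of [R] on the
    tangent space. *)
Definition scale_eps a (x : dual R) : dual R :=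
  Dual (dual_re x) (a * dual_im x).

Lemma scale_eps_zmod a : zmod_morphism (scale_eps a).
Proof. by move=> x y; apply: dual_eq => //=; rewrite mulrBr. Qed.
Lemma scale_eps_monoid a : monoid_morphism (scale_eps a).
Proof. by split=> [|x y]; apply: dual_eq => //=; rewrite ?mulr0 //; ring. Qed.
HB.instance Definition _ a := GRing.isZmodMorphism.Build (dual R) (dual R)
  (scale_eps a) (scale_eps_zmod a).
HB.instance Definition _ a := GRing.isMonoidMorphism.Build (dual R) (dual R)
  (scale_eps a) (scale_eps_monoid a).

Lemma scale_eps_tunit a c : units_map (scale_eps a) (tunit c) = tunit (a * c).
Proof. exact: uval_inj. Qed.
Lemma scale_eps_cunit a u : units_map (scale_eps a) (cunit u) = cunit u.
Proof. by apply: uval_inj; apply: dual_eq => //=; rewrite mulr0. Qed.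

Lemma aug_tunit c : units_map (@dual_aug R) (tunit c) = 0.
Proof. exact: uval_inj. Qed.
End ScaleEps.

Section TangentGenerators.
Variable R : comPzRingType.
Hypotheses (half : is_unit (2%:R : R)) (stab : weakly_stable 5 R).
Implicit Types (a b c : R) (u v w : units R).
Local Notation A := (dual R).
Local Notation inj := (milnorK_map (@dual_inj R)).
Local Notation aug := (milnorK_map (@dual_aug R)).
Local Notation act a := (milnorK_map (scale_eps a)).
Local Notation nil_pairing :=
  (fun u v : units A => cupl u (cupl v (symbol_nil A))).

Let skew n (u v : units A) (x : milnorK n A) :
  cupl u (cupl v x) = - cupl v (cupl u x).
Proof. exact/cupl_skew/dual_stable. Qed.

(** The span of the symbols [{u_1, .., u_n, 1 + c eps}] with [u_i] units of [R],
    presented degree by degree so that an identity compatible with left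
    multiplications has to be verified on [{1 + c eps}] only. It is the whole
    kernel of the augmentation: see [in_tangent_sub_inj]. *)
Inductive in_tangent : forall n, milnorK n.+1 A -> Prop :=
| in_tangent0 n : @in_tangent n 0
| in_tangentB n x y : in_tangent x -> in_tangent y -> @in_tangent n (x - y)
| in_tangent_tunit c : in_tangent (cupl (tunit c) (symbol_nil A))
| in_tangent_cunit n u x : @in_tangent n x -> in_tangent (cupl (cunit u) x).

Lemma in_tangentN n (x : milnorK n.+1 A) : in_tangent x -> in_tangent (- x).
Proof.
by move=> tx; rewrite -sub0r; apply: in_tangentB tx; apply: in_tangent0.
Qed.
Lemma in_tangentD n (x y : milnorK n.+1 A) :
  in_tangent x -> in_tangent y -> in_tangent (x + y).
Proof. by move=> tx /in_tangentN ty; rewrite -[y]opprK; apply: in_tangentB. Qed.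

(** Two entries [1 + c eps] and [1 + d eps] can be made adjacent. *)
Lemma cupl_tunit_in_tangent n c (x : milnorK n.+1 A) :
  in_tangent x -> cupl (tunit c) x = 0.
Proof.
elim=> {n x} [n|n x y _ IHx _ IHy|d|n u x _ IH].
- exact: cupl0.
- by rewrite cuplB IHx IHy subrr.
- apply: (pairing_tunit (beta := nil_pairing) half stab).
  + by move=> ? ? ?; apply: cupl_unitD.
  + by move=> ? ? ?; rewrite cupl_unitD cuplD.
  + by move=> ? ?; apply: cupl_steinberg.
- by rewrite skew IH cupl0 oppr0.
Qed.

(** Anticommutativity moves the entry [1 + c eps] past the constant ones. *)
Lemma in_tangent_cupl_tunit_inj n c (y : milnorK n R) :
  in_tangent (cupl (tunit c) (inj y)).
Proof.
elim/milnorK_cupl_ind: n / y => [n x y IHx IHy|n||n u x IH].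
- by rewrite milnorK_mapB cuplB; apply: in_tangentB.
- by rewrite linear0 cupl0; apply: in_tangent0.
- by rewrite milnorK_map_nil; apply: in_tangent_tunit.
- by rewrite milnorK_map_cupl skew; apply/in_tangentN/in_tangent_cunit.
Qed.

(** A symbol over [R[eps]] differs from its value at [eps = 0] by terms with an
    entry [1 + c eps]. Anticommutativity moves that entry to the end, and terms
    with two such entries vanish. In degree 0 there is no entry to differ in. *)
Lemma in_tangent_sub_inj n (x : milnorK n A) :
  match n return milnorK n A -> Prop with
  | 0 => fun x => x = inj (aug x)
  | n.+1 => fun x => in_tangent (x - inj (aug x))
  end x.
Proof.
elim/milnorK_cupl_ind: n / x => [[|n] x y IHx IHy|[|n]||n w x IH].
- by rewrite !milnorK_mapB -IHx -IHy.
- by rewrite !milnorK_mapB opprD addrACA -opprD; apply: in_tangentB.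
- by rewrite !linear0.
- by rewrite !milnorK_map0 subr0; apply: in_tangent0.
- by rewrite /= !milnorK_map_nil.
have [u [c ->]] := dual_unit_split w.
have augE : units_map (@dual_aug R) (cunit u + tunit c) = u.
  by apply: uval_inj; apply: mulr1.
rewrite !milnorK_map_cupl augE -/(cunit u) cupl_unitD addrAC -cuplB.
case: n x IH => [|n] x IH.
  by rewrite -IH subrr cupl0 add0r IH; apply: in_tangent_cupl_tunit_inj.
apply: in_tangentD; first exact: in_tangent_cunit.
rewrite -[x](subrK (inj (aug x))) cuplD (cupl_tunit_in_tangent _ IH) add0r.
exact: in_tangent_cupl_tunit_inj.
Qed.

Lemma act_cunit n a u (x : milnorK n A) :
  act a (cupl (cunit u) x) = cupl (cunit u) (act a x).
Proof. by rewrite milnorK_map_cupl scale_eps_cunit. Qed.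

Lemma act_tunit a c :
  act a (cupl (tunit c) (symbol_nil A)) = cupl (tunit (a * c)) (symbol_nil A).
Proof. by rewrite milnorK_map_cupl milnorK_map_nil scale_eps_tunit. Qed.

Lemma act_addl n a b (x : milnorK n.+1 A) : in_tangent x ->
  act (a + b) x = act a x + act b x.
Proof.
elim=> {n x} [n|n x y _ IHx _ IHy|d|n u x _ IH].
- by rewrite !linear0 addr0.
- by rewrite !milnorK_mapB IHx IHy opprD addrACA.
- by rewrite !act_tunit mulrDl tunitD cupl_unitD.
- by rewrite !act_cunit IH cuplD.
Qed.

(** In the notation [u . x] for the action, this says that [u |-> u . ({u} x)] is
    additive; on [{1 + c eps}] it is [pairing_additive]. *)
Lemma act_cunit_additive n u v w (x : milnorK n.+1 A) : in_tangent x ->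
  uval u + uval v = uval w ->
  cupl (cunit u) (act (uval u) x) + cupl (cunit v) (act (uval v) x) =
  cupl (cunit w) (act (uval w) x).
Proof.
move=> tx uvw; elim: tx => {n x} [n|n x y _ IHx _ IHy|d|n u' x _ IH].
- by rewrite !(linear0, cupl0) addr0.
- by rewrite !milnorK_mapB !cuplB addrACA IHx -opprD IHy.
- rewrite !act_tunit.
  apply: (pairing_additive (beta := nil_pairing) half stab).
  + by move=> ? ? ?; apply: cupl_unitD.
  + by move=> ? ? ?; rewrite cupl_unitD cuplD.
  + by move=> ? ?; apply: cupl_steinberg.
  + exact: uvw.
- by rewrite !act_cunit !(skew _ (cunit u')) -opprD -cuplD IH.
Qed.
End TangentGenerators.

(** * The tangent space as a module over the base ring *)

(** The additivity of the action of [R] in the scalar rests on the two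
    hypotheses. Making them parameters of the type attaches the module
    structure to it. *)
Definition tangent (R : comPzRingType) (half : is_unit (2%:R : R))
  (stab : weakly_stable 5 R) (n : nat) := TmilnorK n.+1 R.

Section TangentModule.
Variables (R : comPzRingType).
Variables (half : is_unit (2%:R : R)) (stab : weakly_stable 5 R).
Implicit Types (a b : R) (u v : units R) (w : Omega1 R).
Local Notation A := (dual R).
Local Notation T := (tangent half stab).
HB.instance Definition _ n := GRing.Zmodule.on (T n).

Definition tval n (x : T n) : milnorK n.+1 A := val x.

Lemma tval_inj n : injective (@tval n).
Proof. exact: val_inj. Qed.
Lemma tvalD n (x y : T n) : tval (x + y) = tval x + tval y.
Proof. by []. Qed.
Lemma tvalN n (x : T n) : tval (- x) = - tval x.
Proof. by []. Qed.

Lemma tval_aug n (x : T n) : milnorK_map (@dual_aug R) (tval x) = 0.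
Proof. exact: kernelP. Qed.

Lemma tval_in_tangent n (x : T n) : in_tangent (tval x).
Proof.
have := @in_tangent_sub_inj R half stab n.+1 (tval x).
by rewrite tval_aug milnorK_map0 subr0.
Qed.

Lemma tscale_subproof n a (x : T n) :
  milnorK_map (@dual_aug R) (milnorK_map (scale_eps a) (tval x)) = 0.
Proof. by rewrite (@milnorK_map_comp _ _ _ _ _ (@dual_aug R)) ?tval_aug. Qed.
Definition tscale n a (x : T n) : T n := mk_kernel (tscale_subproof a x).

Lemma tscaleA n a b (x : T n) : tscale a (tscale b x) = tscale (a * b) x.
Proof.
apply: tval_inj; apply: milnorK_map_comp => y.
by apply: dual_eq => //=; rewrite mulrA.
Qed.
Lemma tscale1 n : left_id 1 (@tscale n).
Proof.
move=> x; apply: tval_inj; apply: milnorK_map_id => y.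
by apply: dual_eq => //=; rewrite mul1r.
Qed.
Lemma tscaleDr n : right_distributive (@tscale n) +%R.
Proof. by move=> a x y; apply: tval_inj; rewrite tvalD; apply: linearD. Qed.
Lemma tscaleDl n (x : T n) : {morph (@tscale n)^~ x : a b / a + b}.
Proof.
move=> a b; apply: tval_inj; rewrite tvalD.
exact/act_addl/tval_in_tangent.
Qed.
HB.instance Definition _ n := GRing.Zmodule_isLmodule.Build R (T n)
  (@tscaleA n) (@tscale1 n) (@tscaleDr n) (@tscaleDl n).

Lemma tvalZ n a (x : T n) : tval (a *: x) = milnorK_map (scale_eps a) (tval x).
Proof. by []. Qed.

Lemma tcup_subproof n u (x : T n) :
  milnorK_map (@dual_aug R) (cupl (cunit u) (tval x)) = 0.
Proof. by rewrite milnorK_map_cupl tval_aug cupl0. Qed.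
Definition tcup n u (x : T n) : T n.+1 := mk_kernel (tcup_subproof u x).

Lemma tval_tcup n u (x : T n) : tval (tcup u x) = cupl (cunit u) (tval x).
Proof. by []. Qed.

Lemma tcupD n u (x y : T n) : tcup u (x + y) = tcup u x + tcup u y.
Proof. by apply: tval_inj; rewrite tvalD !tval_tcup tvalD cuplD. Qed.
Lemma tcupZ n u a (x : T n) : tcup u (a *: x) = a *: tcup u x.
Proof. by apply: tval_inj; rewrite tvalZ !tval_tcup tvalZ act_cunit. Qed.
Lemma tcup_unitD n u v (x : T n) : tcup (u + v) x = tcup u x + tcup v x.
Proof. by apply: tval_inj; rewrite tvalD !tval_tcup cunitD cupl_unitD. Qed.
Lemma tcup_skew n u v (x : T n) : tcup u (tcup v x) = - tcup v (tcup u x).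
Proof.
by apply: tval_inj; rewrite tvalN !tval_tcup cupl_skew //; apply: dual_stable.
Qed.

(** Anticommutativity gives [2 {u, u} = 0], and 2 is invertible. *)
Lemma tcup_sqr n u (x : T n) : tcup u (tcup u x) = 0.
Proof.
have [h hE] := half.
have -> : x = h *: x + h *: x.
  by rewrite -scalerDl -mulr2n -mulr_natl hE scale1r.
by rewrite !tcupD {1}tcup_skew addNr.
Qed.

(** ** Multiplication by differentials *)

Section Differential.
Variables (n : nat) (x : T n).

Lemma tcup_additive u v (t : units R) : uval u + uval v = uval t ->
  uval u *: tcup u x + uval v *: tcup v x = uval t *: tcup t x.
Proof.
move=> uvw; apply: tval_inj; rewrite tvalD !tvalZ !tval_tcup !act_cunit.
exact: act_cunit_additive (tval_in_tangent x) uvw.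
Qed.

(** On a unit [u], the product of [dlog u] and [x] has to be [{u} x], so that of
    [du] and [x] is [u . ({u} x)]. *)
Definition tder : R -> T n.+1 :=
  additive_ext stab (fun u => uval u *: tcup u x).

Lemma tder_unit u : tder (uval u) = uval u *: tcup u x.
Proof. exact/additive_ext_unit/tcup_additive. Qed.
Lemma tderD : {morph tder : a b / a + b}.
Proof. exact/additive_extD/tcup_additive. Qed.

Lemma tder_derivation : derivation_for idfun tder.
Proof.
split; first exact: tderD.
move=> a b; apply: (additive_ext_eq stab (f := fun a => tder (a * b))
  (g := fun a => a *: tder b + b *: tder a)).
- by move=> r s /=; rewrite mulrDl tderD.
- move=> r s /=; rewrite tderD scalerDl [b *: (_ + _)]scalerDr.
  by rewrite addrACA.
move=> u; apply: (additive_ext_eq stab (f := fun b => tder (uval u * b))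
  (g := fun b => uval u *: tder b + b *: tder (uval u))).
- by move=> r s /=; rewrite mulrDr tderD.
- move=> r s /=; rewrite tderD scalerDl [uval u *: (_ + _)]scalerDr.
  by rewrite addrACA.
move=> v; rewrite -uvalD !tder_unit tcup_unitD scalerDr addrC !scalerA uvalD.
by rewrite [uval v * _]mulrC.
Qed.

Definition tmul (w : Omega1 R) : T n.+1 := kahler_lift tder_derivation w.

Lemma tmulP a w w' : tmul (a *: w + w') = a *: tmul w + tmul w'.
Proof. exact: (linearP (kahler_lift tder_derivation)). Qed.
Lemma tmul0 : tmul 0 = 0.
Proof. exact: (linear0 (kahler_lift tder_derivation)). Qed.
Lemma tmul_kd u : tmul (kd (uval u)) = uval u *: tcup u x.
Proof. by rewrite -tder_unit; apply: kahler_lift_kd. Qed.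
Lemma tmul_dlog u : tmul (dlog1 u) = tcup u x.
Proof.
rewrite -[dlog1 u]addr0 tmulP tmul0 addr0 tmul_kd scalerA mulrC uvalK.
exact: scale1r.
Qed.
End Differential.

(** Additive generation of [R] by units makes the [dlog1 u] generators of the
    module of differentials. *)
Lemma Omega1_dlog_ind (P : Omega1 R -> Prop) :
  P 0 -> (forall a u w, P w -> P (a *: dlog1 u + w)) -> forall w, P w.
Proof.
move=> P0 PS; elim/Omega1_ind => [//|a b w Pw].
have kdE u : kd (uval u) = uval u *: dlog1 u.
  by rewrite /dlog1 scalerA uvalK scale1r.
have [u [v ->]] := unit_difference stab b.
rewrite kdD kdN !kdE scalerBr ![a *: (_ *: dlog1 _)]scalerA -addrA -scaleNr.
by apply/PS/PS.
Qed.

Lemma tmulxP n w a (x y : T n) : tmul (a *: x + y) w = a *: tmul x w + tmul y w.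
Proof.
elim/Omega1_dlog_ind: w => [|b u w IH]; first by rewrite !tmul0 scaler0 addr0.
rewrite !tmulP IH !tmul_dlog tcupD tcupZ !scalerDr !scalerA [b * a]mulrC.
by rewrite addrACA.
Qed.
Lemma tmulx0 n w : tmul (0 : T n) w = 0.
Proof.
have := tmulxP w 1 0 (0 : T n); rewrite scaler0 addr0 scale1r => H.
by apply: (addrI (tmul (0 : T n) w)); rewrite -H addr0.
Qed.

Lemma tmul_skew n w w' (x : T n) : tmul (tmul x w') w = - tmul (tmul x w) w'.
Proof.
elim/Omega1_dlog_ind: w => [|a u w IH]; first by rewrite !tmul0 tmulx0 oppr0.
rewrite !tmulP tmulxP opprD IH -scalerN !tmul_dlog; congr (_ *: _ + _).
elim/Omega1_dlog_ind: w' {IH} => [|b v w' IH].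
  by rewrite !tmul0 -[0](scale0r 0) tcupZ !scale0r oppr0.
by rewrite !tmulP tcupD tcupZ IH !tmul_dlog tcup_skew opprD -scalerN.
Qed.

(** Squares of the generators [dlog1 u] vanish by [tcup_sqr], and the cross terms
    cancel by [tmul_skew]. *)
Lemma tmul_sqr n w (x : T n) : tmul (tmul x w) w = 0.
Proof.
elim/Omega1_dlog_ind: w => [|a u w IH]; first by rewrite tmul0.
rewrite !tmulP !tmulxP IH addr0 !tmul_dlog tcup_sqr scaler0 add0r.
rewrite -[tcup u x]tmul_dlog [tmul (tmul _ _) w]tmul_skew tmul_dlog scalerN.
exact: subrr.
Qed.
End TangentModule.

(** * The inverse map *)

Section Inverse.
Variables (R : comPzRingType).
Variables (half : is_unit (2%:R : R)) (stab : weakly_stable 5 R).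
Implicit Types (a b : R) (u v : units R) (w : Omega1 R).
Local Notation A := (dual R).
Local Notation T := (tangent half stab).

Lemma tbase_subproof :
  milnorK_map (@dual_aug R) (cupl (tunit 1) (symbol_nil A)) = 0.
Proof. by rewrite milnorK_map_cupl aug_tunit cupl_unit0. Qed.
Definition tbase : T 0 := mk_kernel tbase_subproof.

Fixpoint iter_tmul n : {ffun 'I_n -> Omega1 R} -> T n :=
  if n is m.+1 then fun f => tmul (iter_tmul (ftail f)) (f ord0)
  else fun=> tbase.

Lemma iter_tmul_fcons n w (f : {ffun 'I_n -> Omega1 R}) :
  iter_tmul (fcons w f) = tmul (iter_tmul f) w.
Proof. by rewrite /= ftail_fcons fcons0. Qed.

Lemma tmulxZ n a w (x : T n) : tmul (a *: x) w = a *: tmul x w.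
Proof. by rewrite -[a *: x]addr0 tmulxP tmulx0 addr0. Qed.
Lemma tmulxD n w (x y : T n) : tmul (x + y) w = tmul x w + tmul y w.
Proof. by rewrite -[x in LHS]scale1r tmulxP scale1r. Qed.
Lemma tmulZ n a w (x : T n) : tmul x (a *: w) = a *: tmul x w.
Proof. by rewrite -[a *: w]addr0 tmulP tmul0 addr0. Qed.
Lemma tmulD n w w' (x : T n) : tmul x (w + w') = tmul x w + tmul x w'.
Proof. by rewrite -[w in LHS]scale1r tmulP scale1r. Qed.

Lemma iter_tmul_multilinear n : multilinear_for idfun (@iter_tmul n).
Proof.
elim: n => [|n [IHD IHZ]]; first by split=> f [].
split=> [f i x y|f i a x]; rewrite [f]fconsE;
  case: (unliftP ord0 i) => [j|] ->;
  rewrite ?upd_fcons0 ?upd_fconsS !iter_tmul_fcons.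
- by rewrite IHD tmulxD.
- by rewrite tmulD.
- by rewrite IHZ tmulxZ.
- by rewrite tmulZ.
Qed.

Lemma tmul_iter_mem n w (f : {ffun 'I_n -> Omega1 R}) i :
  f i = w -> tmul (iter_tmul f) w = 0.
Proof.
elim: n f i => [|n IH] f; first by case.
move=> i; rewrite [f]fconsE iter_tmul_fcons.
case: (unliftP ord0 i) => [j|] ->; last first.
  by rewrite fcons0 => ->; rewrite tmul_sqr.
by rewrite fconsS => fj; rewrite tmul_skew (IH _ j fj) tmulx0 oppr0.
Qed.

Lemma iter_tmul_alternating n : alternating (@iter_tmul n).
Proof.
elim: n => [|n IH] f i j; first by case: i.
rewrite [f]fconsE iter_tmul_fcons.
case: (unliftP ord0 i) => [i'|] ->; case: (unliftP ord0 j) => [j'|] ->.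
- by rewrite (inj_eq lift_inj) !fconsS => ij fij; rewrite (IH _ i' j') ?tmulx0.
- by rewrite fcons0 fconsS => _; apply: tmul_iter_mem.
- by rewrite fcons0 fconsS => _ /esym; apply: tmul_iter_mem.
- by rewrite eqxx.
Qed.

(** Inverse to B up to the sign [(-1)^n]. *)
Definition Binv n : Omega n R -> T n :=
  ext_lift (iter_tmul_multilinear n) (@iter_tmul_alternating n).

Lemma BinvP n a (x y : Omega n R) : Binv (a *: x + y) = a *: Binv x + Binv y.
Proof. exact: (linearP (ext_lift (iter_tmul_multilinear n) _)). Qed.
Lemma Binv0 n : Binv (0 : Omega n R) = 0.
Proof. exact: (linear0 (ext_lift (iter_tmul_multilinear n) _)). Qed.
Lemma Binv_wedge n f : @Binv n (wedge f) = iter_tmul f.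
Proof. exact: ext_lift_wedge. Qed.

Lemma Binv_wedgel n w (x : Omega n R) : Binv (wedgel w x) = tmul (Binv x) w.
Proof.
elim/ext_ind: x => [|a f x IH]; first by rewrite wedgel0 !Binv0 tmulx0.
rewrite wedgelD wedgelZ wedgel_wedge !BinvP IH tmulxP !Binv_wedge.
by rewrite iter_tmul_fcons.
Qed.

(** The image is closed under the operations that generate the tangent space:
    left multiplication by [{u}] is the product with [dlog1 u], and
    [{1 + c eps}] is [c] times the image of the empty form. *)
Lemma Binv_surj n (x : T n) : exists y : Omega n R, Binv y = x.
Proof.
suff [y yE] : exists y : Omega n R, tval (Binv y) = tval x.
  by exists y; apply: tval_inj.
elim: (tval_in_tangent x) => {n x} [n|n _ _ _ [x <-] _ [y <-]|c|n u _ _ [y <-]].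
- by exists 0; rewrite Binv0.
- exists ((- 1) *: y + x).
  by rewrite BinvP scaleN1r addrC.
- exists (c *: wedge [ffun=> 0] + 0).
  by rewrite BinvP Binv0 addr0 Binv_wedge tvalZ [tval _]/= act_tunit mulr1.
- exists (wedgel (dlog1 u) y).
  by rewrite Binv_wedgel tmul_dlog.
Qed.
End Inverse.

(** * B on the image of the inverse map *)

Section Composite.
Variables (R : comPzRingType).
Variables (half : is_unit (2%:R : R)) (stab : weakly_stable 5 R).
Implicit Types (a b : R) (u v : units R) (w : Omega1 R).
Local Notation A := (dual R).
Local Notation T := (tangent half stab).

Lemma dlogP n (a : int) (x y : milnorK n A) :
  dlog (a *: x + y) = a%:~R *: dlog x + dlog y.
Proof. by rewrite linearP. Qed.

Lemma dlog_cupl n (u : units A) (x : milnorK n A) :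
  dlog (cupl u x) = wedgel (dlog1 u) (dlog x).
Proof.
elim/milnorK_ind: x => [|a f x IH]; first by rewrite cupl0 !linear0.
rewrite cuplP !dlogP IH wedgelD wedgelZ cupl_symbol !dlog_symbol wedgel_wedge.
by congr (_ *: wedge _ + _); apply: (fmap_fcons (@dlog1 A)).
Qed.

(** The contraction is an antiderivation over the augmentation. *)
Lemma contr_eps_wedgel n (w : Omega1 A) (x : Omega n.+1 A) :
  contr_eps (wedgel w x) = (deps_coef w : R) *: Omega_map (@dual_aug R) x
    - wedgel (Omega1_map (@dual_aug R) w) (contr_eps x).
Proof.
have cP m (a : A) (y z : Omega m.+1 A) :
  contr_eps (a *: y + z) = dual_aug a *: contr_eps y + contr_eps z :> Omega m R.
  by rewrite linearP.
have oP (a : A) (y z : Omega n.+1 A) : Omega_map (@dual_aug R) (a *: y + z) =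
  dual_aug a *: Omega_map (@dual_aug R) y + Omega_map (@dual_aug R) z.
  by rewrite linearP.
elim/ext_ind: x => [|a f x IH].
  have c0 m : contr_eps (0 : Omega m.+1 A) = 0 :> Omega m R by exact: linear0.
  have o0 : Omega_map (@dual_aug R) (0 : Omega n.+1 A) = 0 by exact: linear0.
  by rewrite wedgel0 !c0 o0 wedgel0 scaler0 subr0.
rewrite wedgelD wedgelZ wedgel_wedge !cP IH oP wedgelD wedgelZ.
rewrite [contr_eps (wedge _)]ext_lift_wedge [contr_eps (wedge _)]ext_lift_wedge.
rewrite contr_fun_fconsS [Omega_map _ (wedge f)]ext_map_wedge.
rewrite [_ *: (_ - _)]scalerBr [in RHS]scalerDr opprD [in RHS]addrACA.
by rewrite !scalerA [_ * dual_aug a]mulrC.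
Qed.

Definition Bval n (x : milnorK n.+1 A) : Omega n R := contr_eps (dlog x).

Lemma BmapE n (x : T n) : Bmap n R x = Bval (tval x).
Proof. exact: proj_depsE. Qed.

Lemma BvalD n (x y : milnorK n.+1 A) : Bval (x + y) = Bval x + Bval y.
Proof. by rewrite /Bval !linearD. Qed.
Lemma BvalB n (x y : milnorK n.+1 A) : Bval (x - y) = Bval x - Bval y.
Proof. by rewrite /Bval !linearB. Qed.
Lemma Bval0 n : Bval (0 : milnorK n.+1 A) = 0.
Proof. by rewrite /Bval !linear0. Qed.

(** A constant unit has no [d eps] component, so only the second term of
    [contr_eps_wedgel] remains. *)
Lemma Bval_cunit n u (x : milnorK n.+1 A) :
  Bval (cupl (cunit u) x) = - wedgel (dlog1 u) (Bval x).
Proof.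
rewrite /Bval dlog_cupl contr_eps_wedgel.
have -> : (deps_coef (dlog1 (cunit u)) : R) = 0.
  rewrite /dlog1 linearZ /= [deps_coef (kd _)]kahler_lift_kd /=.
  exact: mulr0.
have -> : Omega1_map (@dual_aug R) (dlog1 (cunit u)) = dlog1 u.
  by rewrite /dlog1 linearZ /= Omega1_map_kd.
by rewrite scale0r sub0r.
Qed.

Lemma Bval_tunit a :
  Bval (cupl (tunit a) (symbol_nil A)) = a *: wedge [ffun=> 0].
Proof.
rewrite /Bval cupl_symbol dlog_symbol.
rewrite [LHS]ext_lift_wedge /= !ffunE unlift_none.
have -> : (deps_coef (dlog1 (tunit a)) : R) = a.
  rewrite /dlog1 linearZ /= [deps_coef (kd _)]kahler_lift_kd /=.
  exact: mul1r.
by congr (_ *: wedge _); apply/ffunP; case.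
Qed.

Lemma Bval_scale n a (x : milnorK n.+1 A) : in_tangent x ->
  Bval (milnorK_map (scale_eps a) x) = a *: Bval x.
Proof.
elim=> {n x} [n|n x y _ IHx _ IHy|c|n u x _ IH].
- by rewrite milnorK_map0 Bval0 scaler0.
- by rewrite milnorK_mapB !BvalB IHx IHy scalerBr.
- by rewrite act_tunit !Bval_tunit scalerA.
- by rewrite act_cunit !Bval_cunit IH wedgelZ scalerN.
Qed.

Lemma Bval_tmul n w (x : T n) :
  Bval (tval (tmul x w)) = - wedgel w (Bval (tval x)).
Proof.
elim/(Omega1_dlog_ind stab): w => [|a u w IH].
  by rewrite tmul0 wedgelw0 Bval0 oppr0.
rewrite tmulP tvalD BvalD IH tvalZ Bval_scale; last exact: tval_in_tangent.
rewrite tmul_dlog tval_tcup Bval_cunit wedgelwD [wedgel (a *: _) _]wedgelwZ.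
by rewrite opprD scalerN.
Qed.

(** Each of the [n] left multiplications contributes a sign, since [d eps] is
    contracted through the corresponding 1-form ([Bval_tmul]). *)
Lemma BmapK n (y : Omega n R) : Bmap n R (Binv half stab y) = (-1) ^+ n *: y.
Proof.
rewrite BmapE; elim/ext_ind: y => [|a f y IH].
  by rewrite Binv0 Bval0 scaler0.
rewrite BinvP tvalD BvalD IH tvalZ Bval_scale; last exact: tval_in_tangent.
rewrite scalerDr Binv_wedge; congr (_ + _).
rewrite [RHS]scalerA mulrC -scalerA; congr (_ *: _) => {a y IH}.
elim: n f => [|n IH] f.
  rewrite Bval_tunit expr0; congr (_ *: wedge _).
  by apply/ffunP; case.
rewrite [f]fconsE iter_tmul_fcons Bval_tmul IH wedgelZ wedgel_wedge exprS.
by rewrite mulN1r scaleNr.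
Qed.
End Composite.

Theorem theorem2p9 (n : nat) (R : comPzRingType)
  (half : is_unit (2%:R : R)%R) (stab : weakly_stable 5 R) :
  bijective (Bmap n R).
Proof.
have sgn (y : Omega n R) : (-1) ^+ n *: ((-1) ^+ n *: y) = y.
  by rewrite scalerA -expr2 sqrr_sign scale1r.
exists (fun y => Binv half stab ((-1) ^+ n *: y)) => [x|y].
  by have [y <-] := Binv_surj (x : tangent half stab n); rewrite BmapK sgn.
by rewrite BmapK sgn.
Qed.
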